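(* Let $k$ be an algebraically closed field with $\operatorname{char}(k)\neq 2$ and let $\mathcal{A}=k\langle x_1,\dots,x_n\rangle/\big((x_1,\dots,x_n)^3+(S)\big)$, where $S=\sum_{i,j=1}^n a_{ij}x_ix_j$ with $a_{ij}\in k$ and $\det(a_{ij})\neq 0$. Let $\underline{d}=(d_0,d_1,d_2)$ be a dimension vector for radical layering, $d=d_0+d_1+d_2$, such that $\overline{\operatorname{rep}_{\underline{d}}(\mathcal{A})}$ is an irreducible component of $\operatorname{rep}_d(\mathcal{A})$. Then the generic dimension $\underline{\operatorname{sdim}}(\operatorname{rep}(\underline{d},\mathcal{A}))$ of the socle layering on $\operatorname{rep}(\underline{d},\mathcal{A})$ equals: - $\big((n^2-1)(a-1),\,n(a-1)+1,\,a-1\big)$ if $\underline{d}=\big(a,\,n(a-1),\,(n^2-1)(a-1)\big)$ for some $a\in\mathbb{N}$; - $\big(a,\,n(a-1),\,(n^2-1)(a-1)\big)$ if $\underline{d}=\big((n^2-1)(a-1),\,n(a-1)+1,\,a-1\big)$ for some $a\in\mathbb{N}$; - $(d_2,d_1,d_0)$ otherwise.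
   Context: $\operatorname{rep}_d(\mathcal{A})$ is the closed subvariety (with reduced structure) of $\operatorname{Mat}_{d\times d}(k)^n$ of tuples $M=(M_1,\dots,M_n)$ with $M_iM_jM_l=0$ for all $i,j,l$ and $\sum_{i,j}a_{ij}M_iM_j=0$, identified with $\mathcal{A}$-module structures on $k^d$. $\operatorname{GL}_d(k)$ acts by simultaneous conjugation. For an $\mathcal{A}$-module $M$: $\operatorname{rad}^iM=(\operatorname{rad}\mathcal{A})^i M$ and $\operatorname{soc}^iM=\{m\in M: (\operatorname{rad}\mathcal{A})^i m=0\}$, where $\operatorname{rad}\mathcal{A}$ is the ideal generated by $x_1,\dots,x_n$. The dimension of the socle layering of $M$ is $\underline{\operatorname{sdim}}(M)=(\dim \operatorname{soc}^{i+1}M/\operatorname{soc}^{i}M)_{i=0,1,2}$. For a vector $\underline{d}=(d_0,d_1,d_2)$ of non-negative integers with sum $d$, $\operatorname{rep}(\underline{d},\mathcal{A})=\{M\in\operatorname{rep}_d(\mathcal{A}):\operatorname{rad}^iM=\langle e_1,\dots,e_{D_i}\rangle\ \forall i\}$ with $D_i=\sum_{j\ge i}d_j$ and $e_1,\dots,e_d$ the standard basis of $k^d$, and $\operatorname{rep}_{\underline{d}}(\mathcal{A})=\operatorname{GL}_d(k)\cdot\operatorname{rep}(\underline{d},\mathcal{A})$. The varieties $\operatorname{rep}(\underline d,\mathcal A)$ and $\operatorname{rep}_{\underline{d}}(\mathcal A)$ are irreducible when nonempty. The generic dimension of the socle layering is the constant value taken by $\underline{\operatorname{sdim}}$ on a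 nonempty open subset of $\operatorname{rep}(\underline{d},\mathcal{A})$.
   Formalization: The formal theorem assumes n ≥ 2 and excludes d = (1,0,0) and d = (1,1,0); there (and for n ≤ 1, d ≠ 0) the claim is false, e.g. for d = (1,0,0) the generic socle layering is (1,0,0), not (0,1,0). *)

(* Defs.v *)
From HB Require Import structures.
From mathcomp Require Import all_boot all_order all_algebra.
From mathcomp Require Import classical_sets.
From mathcomp Require Import mpoly.

Set Implicit Arguments.
Unset Strict Implicit.
Unset Printing Implicit Defensive.

Import GRing.Theory.

Local Open Scope ring_scope.
Local Open Scope classical_set_scope.

(* [tuples k n d] is the set of k-points of the affine space Mat_{dxd}(k)^n;
   matrices act on column vectors from the left. *)
Definition tuples (k : closedFieldType) (n d : nat) := {ffun 'I_n -> 'M[k]_d}.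

Section Zariski.
Variables (k : closedFieldType) (n d : nat).

Definition coord : finType := ('I_n * 'I_d * 'I_d)%type.

(* The variable of index t is the matrix entry whose coordinate triple has rank
   t in the enumeration of [coord]. *)
Definition poly_eval (p : {mpoly k[#|coord|]}) (M : tuples k n d) : k :=
  p.@[fun t => M (enum_val t).1.1 (enum_val t).1.2 (enum_val t).2].

Definition zariski_closed (Z : set (tuples k n d)) : Prop :=
  exists F : set {mpoly k[#|coord|]},
    Z = [set M | forall p, F p -> poly_eval p M = 0].

Definition zariski_closure (Y : set (tuples k n d)) : set (tuples k n d) :=
  \bigcap_(Z in [set Z | zariski_closed Z /\ Y `<=` Z]) Z.

Definition open_in (X U : set (tuples k n d)) : Prop :=
  exists2 Z, zariski_closed Z & U = X `\` Z.

Definition irreducible (Y : set (tuples k n d)) : Prop :=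
  Y !=set0 /\
  forall Z1 Z2, zariski_closed Z1 -> zariski_closed Z2 ->
    Y `<=` Z1 `|` Z2 -> Y `<=` Z1 \/ Y `<=` Z2.

Definition irreducible_component (X C : set (tuples k n d)) : Prop :=
  [/\ C `<=` X, irreducible C &
      forall C', irreducible C' -> C `<=` C' -> C' `<=` X -> C' = C].

End Zariski.

Section Layerings.
Variables (k : closedFieldType) (n d : nat) (M : tuples k n d).

Definition word_act (w : seq 'I_n) : 'End('cV[k]_d) :=
  linfun (mulmx (\prod_(j <- w) M j : 'M[k]_d)).

(* (rad A)^i is generated, both as a left and as a right ideal, by the words of
   length exactly i in the generators x_1, ..., x_n. *)
Definition mod_rad (i : nat) : {vspace 'cV[k]_d} :=
  (\sum_(w : i.-tuple 'I_n) limg (word_act w))%VS.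

Definition mod_soc (i : nat) : {vspace 'cV[k]_d} :=
  (\bigcap_(w : i.-tuple 'I_n) lker (word_act w))%VS.

(* mod_soc i is contained in mod_soc i.+1, so the truncated difference is the
   dimension of the quotient. *)
Definition sdim : 3.-tuple nat :=
  [tuple (\dim (mod_soc i.+1) - \dim (mod_soc i))%N | i < 3].

End Layerings.

Definition std_flag (k : closedFieldType) (d m : nat) : {vspace 'cV[k]_d} :=
  <<[seq (delta_mx j ord0 : 'cV[k]_d) | j : 'I_d <- enum 'I_d & (j < m)%N]>>%VS.

Definition vec3 (d0 d1 d2 : nat) : 3.-tuple nat := [tuple d0; d1; d2].

Definition dvec_tail (dv : 3.-tuple nat) (i : nat) : nat :=
  (\sum_(j < 3 | i <= j) tnth dv j)%N.

Definition dvec_total (dv : 3.-tuple nat) : nat := (\sum_(j < 3) tnth dv j)%N.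

Section RepVarieties.
Variables (k : closedFieldType) (n : nat) (a : 'M[k]_n).

Definition rep_var (d : nat) : set (tuples k n d) :=
  [set M | (forall i j l, M i *m M j *m M l = 0) /\
           \sum_i \sum_j a i j *: (M i *m M j) = 0].

Definition rep_std (dv : 3.-tuple nat) : set (tuples k n (dvec_total dv)) :=
  [set M | rep_var M /\
           forall i : nat, mod_rad M i = std_flag k (dvec_total dv) (dvec_tail dv i)].

Definition conj_tuple (d : nat) (g : 'M[k]_d) (M : tuples k n d) : tuples k n d :=
  [ffun j => g *m M j *m invmx g].

Definition rep_dvec (dv : 3.-tuple nat) : set (tuples k n (dvec_total dv)) :=
  [set M | exists g N, [/\ g \in unitmx, rep_std N & M = conj_tuple g N]].

Definition generic_sdim (dv s : 3.-tuple nat) : Prop :=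
  exists U, [/\ open_in (@rep_std dv) U, U !=set0 &
                forall M, U M -> sdim M = s].

End RepVarieties.

(* The two exceptional families of layerings.  They are meant for 0 < b: for
   b = 0 the entries that contain b - 1 would be negative. *)
Definition layering1 (n b : nat) : 3.-tuple nat :=
  vec3 b (n * (b - 1)) ((n ^ 2 - 1) * (b - 1)).

Definition layering2 (n b : nat) : 3.-tuple nat :=
  vec3 ((n ^ 2 - 1) * (b - 1)) (n * (b - 1) + 1) (b - 1).

(* Main.v *)
Require Import Defs.
From mathcomp Require Import all_boot all_order all_algebra.
From mathcomp Require Import classical_sets.
From mathcomp Require Import mpoly.
From mathcomp Require Import boolp zify ring.

(** Let V be the space of row vectors, on which a tuple M acts by v |-> v M_j.
This right module is dual to the module of column vectors: the ranks of
[rad_mx] and [rad2_mx], whose rows span Rad = sum V M_j and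
Rad2 = sum V M_i M_j, are the codimensions of the first two socles on columns,
and the ranks of [act_mx] and [act2_mx], whose kernels are the socles soc and
soc2 of V, are the dimensions of the two radicals on columns.  Transposition
exchanges the two pairs and turns a into its transpose, so that every fact below
has a dual.

Geometry.  In a basis adapted to the radical flag, a point of the variety X of
representations is given by blocks A_j, B_j, C_j with sum a_ij A_i B_j = 0; after
twisting A by a, this says that a row of blocks times a column of blocks
vanishes.  The solutions with second factor of rank r are values of a polynomial
map from an affine space to the solutions, so X is a finite union of irreducible sets
([chart_irreducible], [chart_cover]).  Hence a component C of X contains
a nonempty open subset of X ([component_open]): if M is a general point of C and
M + e E lies in X for all e, then M + e E lies in C for all but finitely many e.
Now choose M with the prescribed radical ranks and with the largest possible
socle codimensions.  Then no line in X through M can raise one of the four ranks.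
This, together with the fact that almost all points of the line are again of the
same kind, is what [generic_class] records.

Linear algebra.  The lines that are used are the pencils M_j + e phi y_j, where
the linear form phi kills Rad, the vectors y_j lie in soc2 and in the kernel of
phi, and sum a_ij y_i M_j = 0.  If u A = 0 and A + e B never has larger rank than
A, then u B lies in the row space of A ([rank_perturb]); applied to the stacked
matrices this yields [pencil_rad], [pencil_soc] and [pencil_soc2].  Put
tau = dim soc2 / Rad and nu = dim soc / Rad2.
- The socle lies in Rad, the simple module excepted ([soc_sub_rad]).
- If tau >= 2 then tau < nu ([layer_growth]), and dually; so tau, nu <= 1.
- If tau = nu = 0, the socle layering is the radical layering reversed.
- If tau = 1 and nu = 0, all syzygies sum u_j M_j = 0 have their u_j in soc2, and
  counting syzygies and relations determines every dimension: this is the first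
  exceptional pair, and tau = 0, nu = 1 is its dual.
- If tau = nu = 1, a further deformation moves the map soc2 / Rad -> soc / Rad2 in
  all directions, which confines the syzygies modulo soc to soc2
  ([syzygy_soc2]); this bound, its dual and the count of relations leave only the
  uniserial module of length two. *)

Set Implicit Arguments.
Unset Strict Implicit.
Unset Printing Implicit Defensive.

Import GRing.Theory.

Local Open Scope ring_scope.

(** * Polynomial functions and semicontinuity of the rank *)

Section FunctionAlgebra.
Variables (k : fieldType) (S : Type) (P : (S -> k) -> Prop).

(** The same closure properties are needed for polynomial functions of one
parameter and for regular functions on tuples, hence the abstract predicate. *)
Record function_algebra : Prop := FunctionAlgebra {
  fa_ext : forall f g, f =1 g -> P f -> P g;
  fa_const : forall c, P (fun=> c);
  fa_add : forall f g, P f -> P g -> P (fun s => f s + g s);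
  fa_mul : forall f g, P f -> P g -> P (fun s => f s * g s) }.

Definition fa_mx m n (A : S -> 'M[k]_(m, n)) : Prop :=
  forall i j, P (fun s => A s i j).

Hypothesis faP : function_algebra.

Lemma fa_sum (I : Type) (r : seq I) (Q : pred I) (f : I -> S -> k) :
  (forall i, P (f i)) -> P (fun s => \sum_(i <- r | Q i) f i s).
Proof.
move=> Pf; elim: r => [|i r IHr].
  by apply: (fa_ext faP) (fa_const faP 0) => s; rewrite big_nil.
case Qi: (Q i).
  by apply: (fa_ext faP) (fa_add faP (Pf i) IHr) => s; rewrite big_cons Qi.
by apply: (fa_ext faP) IHr => s; rewrite big_cons Qi.
Qed.

Lemma fa_prod (I : Type) (r : seq I) (Q : pred I) (f : I -> S -> k) :
  (forall i, P (f i)) -> P (fun s => \prod_(i <- r | Q i) f i s).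
Proof.
move=> Pf; elim: r => [|i r IHr].
  by apply: (fa_ext faP) (fa_const faP 1) => s; rewrite big_nil.
case Qi: (Q i).
  by apply: (fa_ext faP) (fa_mul faP (Pf i) IHr) => s; rewrite big_cons Qi.
by apply: (fa_ext faP) IHr => s; rewrite big_cons Qi.
Qed.

Lemma fa_mx_const m n (A : 'M[k]_(m, n)) : fa_mx (fun=> A).
Proof. by move=> i j; apply: (fa_const faP). Qed.

Lemma fa_mx_add m n (A B : S -> 'M[k]_(m, n)) :
  fa_mx A -> fa_mx B -> fa_mx (fun s => A s + B s).
Proof.
move=> PA PB i j; apply: (fa_ext faP) (fa_add faP (PA i j) (PB i j)) => s.
by rewrite mxE.
Qed.

Lemma fa_mx_scale m n f (A : S -> 'M[k]_(m, n)) :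
  P f -> fa_mx A -> fa_mx (fun s => f s *: A s).
Proof.
move=> Pf PA i j; apply: (fa_ext faP) (fa_mul faP Pf (PA i j)) => s.
by rewrite mxE.
Qed.

Lemma fa_mx_mul m n p (A : S -> 'M[k]_(m, n)) (B : S -> 'M[k]_(n, p)) :
  fa_mx A -> fa_mx B -> fa_mx (fun s => A s *m B s).
Proof.
move=> PA PB i j.
have Pij : P (fun s => \sum_l A s i l * B s l j).
  by apply: fa_sum => l; apply: (fa_mul faP).
by apply: (fa_ext faP) Pij => s; rewrite mxE.
Qed.

Lemma fa_mx_sum (I : Type) (r : seq I) (Q : pred I) m n
    (A : I -> S -> 'M[k]_(m, n)) :
  (forall i, fa_mx (A i)) -> fa_mx (fun s => \sum_(i <- r | Q i) A i s).
Proof.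
move=> PA i j.
have Pij : P (fun s => \sum_(l <- r | Q l) A l s i j).
  by apply: fa_sum => l; apply: PA.
by apply: (fa_ext faP) Pij => s; rewrite summxE.
Qed.

Lemma fa_det n (A : S -> 'M[k]_n) : fa_mx A -> P (fun s => \det (A s)).
Proof.
move=> PA; apply: fa_sum => p; apply: (fa_mul faP); first exact: (fa_const faP).
by apply: fa_prod => i; apply: PA.
Qed.

Lemma fa_mx_adj n (A : S -> 'M[k]_n) : fa_mx A -> fa_mx (fun s => \adj (A s)).
Proof.
move=> PA i j.
have Pij : P (fun s => (-1) ^+ (j + i) * \det (row' j (col' i (A s)))).
  apply: (fa_mul faP); first exact: (fa_const faP).
  apply: fa_det => i' j'.
  by apply: (fa_ext faP) (PA (lift j i') (lift i j')) => s; rewrite !mxE.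
by apply: (fa_ext faP) Pij => s; rewrite mxE.
Qed.

Lemma fa_mx_row m n (q_ : 'I_n -> nat) (A : forall i, S -> 'M[k]_(m, q_ i)) :
  (forall i, fa_mx (A i)) -> fa_mx (fun s => \mxrow_i A i s).
Proof.
by move=> PA i j; apply: (fa_ext faP) (PA (tagnat.sig1 j) i (tagnat.sig2 j)) => s; rewrite !mxE.
Qed.

Lemma fa_mx_col m n (q_ : 'I_n -> nat) (A : forall i, S -> 'M[k]_(q_ i, m)) :
  (forall i, fa_mx (A i)) -> fa_mx (fun s => \mxcol_i A i s).
Proof.
by move=> PA i j; apply: (fa_ext faP) (PA (tagnat.sig1 i) (tagnat.sig2 i) j) => s; rewrite !mxE.
Qed.

Lemma fa_mx_subrow m n (q_ : 'I_n -> nat) (A : S -> 'M[k]_(m, \sum_i q_ i)) i :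
  fa_mx A -> fa_mx (fun s => submxrow (A s) i).
Proof.
by move=> PA i' j; apply: (fa_ext faP) (PA i' (tagnat.Rank _ j)) => s; rewrite !mxE.
Qed.

Lemma fa_mx_subcol m n (q_ : 'I_n -> nat) (A : S -> 'M[k]_(\sum_i q_ i, m)) i :
  fa_mx A -> fa_mx (fun s => submxcol (A s) i).
Proof.
by move=> PA i' j; apply: (fa_ext faP) (PA (tagnat.Rank _ i') j) => s; rewrite !mxE.
Qed.

End FunctionAlgebra.

(** A form of the criterion by minors in which the index set of the equations
does not depend on the choice of rows and columns: all compressions L A R to
square matrices of size r are tested. *)
Lemma rank_geP (k : fieldType) m n (A : 'M[k]_(m, n)) r :
  (r <= \rank A)%N <->
  exists (L : 'M[k]_(r, m)) (R : 'M[k]_(n, r)), \det (L *m A *m R) != 0.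
Proof.
split=> [le_r|[L] [R] det_nz].
  exists (pid_mx r *m invmx (col_ebase A)), (invmx (row_ebase A) *m pid_mx r).
  have [le_m le_n] := (rank_leq_row A, rank_leq_col A).
  rewrite -{2}(mulmx_ebase A) !mulmxA mulmxKV ?col_ebase_unit //.
  rewrite mulmxK ?row_ebase_unit // !mul_pid_mx.
  have -> : minn n (minn (minn m (minn r (\rank A))) r) = r by lia.
  by rewrite pid_mx_1 det1 oner_neq0.
have /mxrankS : (L *m A *m R <= A *m R)%MS by rewrite -mulmxA submxMl.
have -> : \rank (L *m A *m R) = r.
  by apply/eqP; rewrite -[_ == _]/(row_free _) row_free_unit unitmxE unitfE.
by move/leq_trans; apply; rewrite mxrankM_maxl.
Qed.

Section Univariate.
Variable k : closedFieldType.

Definition poly_fun (f : k -> k) : Prop := exists q : {poly k}, forall e, f e = q.[e].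

Lemma poly_fun_algebra : function_algebra poly_fun.
Proof.
split=> [f g fg [q fq]|c|f g [p fp] [q gq]|f g [p fp] [q gq]].
- by exists q => e; rewrite -fg.
- by exists c%:P => e; rewrite hornerC.
- by exists (p + q) => e; rewrite hornerD fp gq.
- by exists (p * q) => e; rewrite hornerM fp gq.
Qed.

Lemma poly_fun_id : poly_fun id.
Proof. by exists 'X => e; rewrite hornerX. Qed.

(** A compression of A e0 to an invertible matrix of maximal size has
a determinant that is polynomial in e and does not vanish at e0. *)
Lemma rank_curve m n (A : k -> 'M[k]_(m, n)) e0 : fa_mx poly_fun A ->
  exists2 q : {poly k}, q.[e0] != 0 &
    forall e, q.[e] != 0 -> (\rank (A e0) <= \rank (A e))%N.
Proof.
move=> PA; have /rank_geP [L [R LAR]] := leqnn (\rank (A e0)).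
have [q detq] : poly_fun (fun e => \det (L *m A e *m R)).
  apply: fa_det; first exact: poly_fun_algebra.
  by do 2?[apply: fa_mx_mul; try exact: poly_fun_algebra] => //;
    apply: fa_mx_const; exact: poly_fun_algebra.
by exists q => [|e]; rewrite -detq // => ?; apply/rank_geP; exists L, R.
Qed.

Lemma horner_neq0 (q : {poly k}) e : q.[e] != 0 -> q != 0.
Proof. by apply: contra_neq => ->; rewrite horner0. Qed.

Lemma nonrootP (q : {poly k}) : q != 0 -> exists e, q.[e] != 0.
Proof. by case/closed_nonrootP => e; exists e. Qed.

Lemma fa_mx_line m n (A B : 'M[k]_(m, n)) : fa_mx poly_fun (fun e => A + e *: B).
Proof.
have faP := poly_fun_algebra; apply: fa_mx_add => //; first exact: fa_mx_const.
by apply: fa_mx_scale => //; [exact: poly_fun_id | exact: fa_mx_const].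
Qed.

(** Replace A by a base of its row space and add the row t B, which is t (A + e B)
divided by e.  If t B were not in the row space, the enlarged matrix would have
rank one more than A at e = 0, hence for almost all e. *)
Lemma rank_perturb m n (A B : 'M[k]_(m, n)) (t : 'rV_m) (q : {poly k}) :
    q != 0 -> (forall e, q.[e] != 0 -> (\rank (A + e *: B)%R <= \rank A)%N) ->
  t *m A = 0 -> (t *m B <= A)%MS.
Proof.
move=> q0 max_rk tA; apply/idPn => tB.
have /submxP [P defP] : (row_base A <= A)%MS by rewrite eq_row_base.
have [p p0 rkN] := rank_curve 0 (fa_mx_line (col_mx (row_base A) (t *m B))
  (col_mx (P *m B) 0)).
have /nonrootP [e] : p * q * 'X != 0 by rewrite !mulf_neq0 ?polyX_eq0 ?(horner_neq0 p0).
rewrite !hornerM hornerX !mulf_eq0 !negb_or => /andP [/andP [pe qe] e0].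
have lt_rk : (\rank A < \rank (col_mx (row_base A) (t *m B)))%N.
  have sA : (A <= row_base A + t *m B)%MS by rewrite -(eq_row_base A) addsmxSl.
  rewrite -addsmxE ltn_neqAle mxrankS // andbT (mxrank_leqif_sup sA).
  by apply: contra tB => /(submx_trans _); apply; rewrite addsmxSr.
have {pe} := rkN e pe; rewrite scale0r addr0 => /(leq_trans lt_rk).
apply/negP; rewrite -leqNgt; apply: (leq_trans _ (max_rk e qe)).
apply: mxrankS; rewrite scale_col_mx add_col_mx scaler0 addr0 -addsmxE addsmx_sub.
apply/andP; split.
  by rewrite defP scalemxAr -mulmxDr submxMl.
have -> : t *m B = e^-1 *: (t *m (A + e *: B)).
  by rewrite mulmxDr tA add0r -scalemxAr scalerA mulVf ?scale1r.
by rewrite scalemx_sub ?submxMl.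
Qed.

End Univariate.

(** * Radical and socle layers of a tuple of matrices *)

Section Layers.
Variables (k : closedFieldType) (n d : nat).
Implicit Types (M E : tuples k n d) (v t : 'rV[k]_d) (u y : 'I_n -> 'rV[k]_d).

Definition rad_mx M : 'M[k]_(\sum_(j < n) d, d) := \mxcol_j M j.
Definition rad2_mx M := \mxcol_j (rad_mx M *m M j).
Definition act_mx M : 'M[k]_(d, \sum_(j < n) d) := \mxrow_j M j.
Definition act2_mx M := \mxrow_i (M i *m act_mx M).

Definition layer_ranks M : nat * nat * nat * nat :=
  (\rank (rad_mx M), \rank (rad2_mx M), \rank (act_mx M), \rank (act2_mx M)).

Lemma scale_mxrow m (q_ : 'I_n -> nat) c (B : forall j, 'M[k]_(m, q_ j)) :
  c *: \mxrow_j B j = \mxrow_j (c *: B j).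
Proof. by apply/matrixP => i j; rewrite !mxE. Qed.

Lemma mul_act_mx m (v : 'M_(m, d)) M : v *m act_mx M = \mxrow_j (v *m M j).
Proof. exact: mul_mxrow. Qed.

Lemma mul_act2_mx m (v : 'M_(m, d)) M :
  v *m act2_mx M = \mxrow_i (\mxrow_j (v *m M i *m M j)).
Proof.
by rewrite /act2_mx mul_mxrow; apply: eq_mxrow => i; rewrite mulmxA mul_act_mx.
Qed.

Lemma act2_mxE M : act2_mx M = \mxrow_i \mxrow_j (M i *m M j).
Proof. by rewrite -[LHS]mul1mx mul_act2_mx; do 2!apply: eq_mxrow => ?; rewrite mul1mx. Qed.

Lemma rad2_mxE M : rad2_mx M = \mxcol_j \mxcol_i (M i *m M j).
Proof. by apply: eq_mxcol => j; rewrite mxcol_mul. Qed.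

Lemma act_mx_eqP m (v w : 'M_(m, d)) M :
  v *m act_mx M = w *m act_mx M <-> forall j, v *m M j = w *m M j.
Proof.
rewrite !mul_act_mx; split=> [/eq_mxrowP //|eqvw]; exact: eq_mxrow.
Qed.

Lemma socP v M : (v <= kermx (act_mx M))%MS <-> forall j, v *m M j = 0.
Proof.
split=> [/sub_kermxP|v0].
  by rewrite -(mul0mx _ (act_mx M)) => /act_mx_eqP vM j; rewrite vM mul0mx.
by apply/sub_kermxP; rewrite -(mul0mx _ (act_mx M)); apply/act_mx_eqP => j; rewrite v0 mul0mx.
Qed.

Lemma soc2P v M :
  (v <= kermx (act2_mx M))%MS <-> forall i j, v *m M i *m M j = 0.
Proof.
split=> [/sub_kermxP|v0].
  rewrite -(mul0mx _ (act2_mx M)) !mul_act2_mx => /eq_mxrowP vM i j.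
  by have /eq_mxrowP/(_ j) := vM i; rewrite !mul0mx.
apply/sub_kermxP; rewrite -(mul0mx _ (act2_mx M)) !mul_act2_mx.
by apply: eq_mxrow => i; apply: eq_mxrow => j; rewrite v0 !mul0mx.
Qed.

Lemma mul_rad_mx u M : (\mxrow_j u j) *m rad_mx M = \sum_j u j *m M j.
Proof. exact: mul_mxrow_mxcol. Qed.

Lemma radP v M : (v <= rad_mx M)%MS <-> exists u, v = \sum_j u j *m M j.
Proof.
split=> [/submxP [w ->]|[u ->]]; last by rewrite -mul_rad_mx submxMl.
by exists (submxrow w); rewrite -mul_rad_mx submxrowK.
Qed.

Lemma rad2P v M : (v <= rad2_mx M)%MS <->
  exists2 u, forall j, (u j <= rad_mx M)%MS & v = \sum_j u j *m M j.
Proof.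
split=> [/submxP [w ->]|[u uR ->]].
  exists (fun j => submxrow w j *m rad_mx M) => [j|]; first exact: submxMl.
  rewrite -{1}(submxrowK w) mul_mxrow_mxcol.
  by apply: eq_bigr => j _; rewrite mulmxA.
apply: summx_sub => j _; have /submxP [w ->] := uR j; rewrite -mulmxA.
apply: mulmx_sub; apply/row_subP => i; apply: (submx_trans (row_sub _ _)).
rewrite eqmx_col (sumsmx_sup j) // genmxE //.
Qed.

Lemma mul_sub_rad m (A : 'M_(m, d)) M j : (A *m M j <= rad_mx M)%MS.
Proof.
by apply: mulmx_sub; rewrite eqmx_col (sumsmx_sup j) // genmxE.
Qed.

Lemma mul_sub_rad2 m (A : 'M_(m, d)) M j :
  (A <= rad_mx M)%MS -> (A *m M j <= rad2_mx M)%MS.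
Proof.
move/submxP=> [w ->]; rewrite -mulmxA; apply: mulmx_sub.
by rewrite eqmx_col (sumsmx_sup j) // genmxE.
Qed.

Lemma separate m (A : 'M[k]_(m, d)) t : ~~ (t <= A)%MS ->
  exists2 phi : 'cV_d, A *m phi = 0 & t *m phi != 0.
Proof.
rewrite submxE => /rV0Pn [j tj].
exists (cokermx A *m delta_mx j 0); rewrite mulmxA ?mulmx_coker ?mul0mx //.
rewrite -colE; apply: contraNneq tj => /matrixP/(_ 0 0).
by rewrite !mxE => ->.
Qed.

Lemma rad_annihilator M (phi : 'cV_d) :
  rad_mx M *m phi = 0 <-> forall j, M j *m phi = 0.
Proof.
rewrite mxcol_mul -(@mxcol0 k n (fun=> d)); split => [/eq_mxcolP //|?].
exact: eq_mxcol.
Qed.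

Variable a : 'M[k]_n.

Lemma rad_sub_soc2 M : rep_var a M -> (rad_mx M <= kermx (act2_mx M))%MS.
Proof.
case=> M3 _; rewrite eqmx_col; apply/sumsmx_subP => l _; rewrite genmxE.
apply/row_subP => i; apply/soc2P => i' j.
by rewrite -!row_mul M3; apply/matrixP => ? ?; rewrite !mxE.
Qed.

Lemma rad2_sub_soc M : rep_var a M -> (rad2_mx M <= kermx (act_mx M))%MS.
Proof.
move=> XM; apply/row_subP => i; apply/socP => j.
have /rad2P [u uR ->] := row_sub i (rad2_mx M).
rewrite mulmx_suml big1 // => l _.
have /soc2P := submx_trans (uR l) (rad_sub_soc2 XM); exact.
Qed.

Lemma rad2_sub_rad M : (rad2_mx M <= rad_mx M)%MS.
Proof.
apply/row_subP => i; have /rad2P [u _ ->] := row_sub i (rad2_mx M).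
by apply/radP; exists u.
Qed.

Lemma soc_sub_soc2 M : rep_var a M -> (kermx (act_mx M) <= kermx (act2_mx M))%MS.
Proof.
move=> XM; apply/row_subP => i; apply/soc2P => j l.
by have /socP -> := row_sub i (kermx (act_mx M)); rewrite mul0mx.
Qed.

(** * Rank-one pencils through a generic tuple *)

Definition rank_one (phi : 'cV[k]_d) y : tuples k n d := [ffun j => phi *m y j].

(** Since phi vanishes on the images of M and on the y_j, the second factor of
a product always acts through M, and no term quadratic in e survives. *)
Lemma pencil_mul M phi y e i j :
    (forall j, M j *m phi = 0) -> (forall j, y j *m phi = 0) ->
  (M + e *: rank_one phi y) i *m (M + e *: rank_one phi y) j =
  M i *m M j + e *: (phi *m (y i *m M j)).
Proof.
move=> Mphi yphi; rewrite !ffunE mulmxDl !mulmxDr -!scalemxAr -!scalemxAl.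
rewrite !mulmxA Mphi mul0mx scaler0 addr0 -(mulmxA phi (y i) phi) yphi mulmx0.
by rewrite mul0mx !scaler0 addr0.
Qed.

Lemma pencil_rep M phi y : rep_var a M ->
    (forall j, M j *m phi = 0) -> (forall j, y j *m phi = 0) ->
    (forall i j l, y i *m M j *m M l = 0) ->
    \sum_i \sum_j a i j *: (y i *m M j) = 0 ->
  forall e, rep_var a (M + e *: rank_one phi y).
Proof.
move=> [M3 Ma] Mphi yphi y2 ya e; split=> [i j l|].
  have z1 : M i *m M j *m (phi *m y l) = 0.
    by rewrite mulmxA -(mulmxA (M i)) Mphi mulmx0 mul0mx.
  have z2 : phi *m (y i *m M j) *m M l = 0 by rewrite -mulmxA y2 mulmx0.
  have z3 : phi *m (y i *m M j) *m (phi *m y l) = 0.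
    by rewrite -mulmxA (mulmxA _ phi) -(mulmxA (y i)) Mphi mulmx0 mul0mx mulmx0.
  rewrite pencil_mul // !ffunE mulmxDl !mulmxDr M3 -!scalemxAr -!scalemxAl.
  by rewrite z1 z2 z3 !scaler0 !addr0.
have -> : \sum_i \sum_j a i j *: ((M + e *: rank_one phi y) i *m
     (M + e *: rank_one phi y) j) =
   \sum_i \sum_j a i j *: (M i *m M j) +
   e *: (phi *m \sum_i \sum_j a i j *: (y i *m M j)).
  rewrite mulmx_sumr scaler_sumr -big_split; apply: eq_bigr => i _.
  rewrite mulmx_sumr scaler_sumr -big_split; apply: eq_bigr => j _.
  by rewrite pencil_mul // scalerDr -scalemxAr /= !scalerA [e * _]mulrC.
by rewrite Ma ya mulmx0 scaler0 addr0.
Qed.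

(** The class of general points of a component whose socle and radical ranks are
extremal; [gen_line] lets a deformation be iterated, because its general member
is again in the class. *)
Record generic_class (G : tuples k n d -> Prop) : Prop := GenericClass {
  gen_rep : forall M, G M -> rep_var a M;
  gen_line : forall M E, G M -> (forall e, rep_var a (M + e *: E)) ->
    exists2 q : {poly k}, q != 0 & forall e, q.[e] != 0 -> G (M + e *: E);
  gen_ranks : forall M M', G M -> G M' -> layer_ranks M = layer_ranks M' }.

Variable G : tuples k n d -> Prop.
Hypothesis genG : generic_class G.

Section Pencil.
Variables (M : tuples k n d) (phi : 'cV[k]_d) (y : 'I_n -> 'rV[k]_d).
Hypotheses (GM : G M) (Mphi : rad_mx M *m phi = 0).
Hypotheses (yphi : forall j, y j *m phi = 0).
Hypotheses (y2 : forall j, (y j <= kermx (act2_mx M))%MS).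
Hypotheses (ya : \sum_i \sum_j a i j *: (y i *m M j) = 0).

Lemma pencil_line e : rep_var a (M + e *: rank_one phi y).
Proof.
apply: pencil_rep => //; first exact: gen_rep GM; first exact/rad_annihilator.
by move=> i j l; have /soc2P -> := y2 i.
Qed.

Let generic_le m p (f : tuples k n d -> 'M[k]_(m, p)) B (t : 'rV_m) :
    (forall M', G M' -> \rank (f M') = \rank (f M)) ->
    (forall e, f (M + e *: rank_one phi y) = f M + e *: B) ->
  t *m f M = 0 -> (t *m B <= f M)%MS.
Proof.
move=> rkf lin_f; have [q q0 Gq] := gen_line genG GM pencil_line.
by apply: (rank_perturb q0) => e /Gq /rkf; rewrite lin_f => ->.
Qed.

Lemma pencil_rad u : \sum_j u j *m M j = 0 ->
  ((\sum_j u j *m phi *m y j)%R <= rad_mx M)%MS.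
Proof.
move=> uM; have -> : \sum_j (u j *m phi *m y j) = (\mxrow_j u j) *m (\mxcol_j (phi *m y j)).
  by rewrite mul_mxrow_mxcol; apply: eq_bigr => j _; rewrite mulmxA.
apply: (generic_le (f := rad_mx)) => [M' GM'|e|]; last by rewrite mul_rad_mx.
  by have [] := gen_ranks genG GM' GM.
by apply/matrixP => i j; rewrite !mxE !ffunE !mxE.
Qed.

Lemma pencil_soc t : (t <= kermx (act_mx M))%MS -> t *m phi != 0 ->
  exists v, forall j, v *m M j = y j.
Proof.
move=> /sub_kermxP tM tphi.
have : (t *m (phi *m \mxrow_j y j) <= act_mx M)%MS.
  apply: (generic_le (f := act_mx)) => // [M' GM'|e].
    by have [] := gen_ranks genG GM' GM.
  apply/matrixP => i j; rewrite !mxE !ffunE !mxE; congr (_ + _ * _).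
  by apply: eq_bigr => l _; rewrite !mxE.
rewrite mulmxA [t *m phi]mx11_scalar mul_scalar_mx => tM'.
have nz : (t *m phi) 0 0 != 0.
  by apply: contra_neq tphi => t0; rewrite [t *m phi]mx11_scalar t0 raddf0.
move: tM'; rewrite eqmx_scale // => /submxP [v]; rewrite mul_act_mx => /eq_mxrowP vM.
by exists v => j; rewrite vM.
Qed.

Lemma pencil_soc2 t : (t <= kermx (act2_mx M))%MS -> t *m phi != 0 ->
  exists v, forall i, (v *m M i - y i <= kermx (act_mx M))%MS.
Proof.
move=> /sub_kermxP tM tphi.
have : (t *m (phi *m \mxrow_i (y i *m act_mx M)) <= act2_mx M)%MS.
  apply: (generic_le (f := act2_mx)) => // [M' GM'|e].
    by have [] := gen_ranks genG GM' GM.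
  rewrite !act2_mxE mul_mxrow scale_mxrow -mxrowD; apply: eq_mxrow => i.
  rewrite mul_act_mx mul_mxrow scale_mxrow -mxrowD; apply: eq_mxrow => j.
  by rewrite pencil_mul //; apply/rad_annihilator.
rewrite mulmxA [t *m phi]mx11_scalar mul_scalar_mx => tM'.
have nz : (t *m phi) 0 0 != 0.
  by apply: contra_neq tphi => t0; rewrite [t *m phi]mx11_scalar t0 raddf0.
move: tM'; rewrite eqmx_scale // => /submxP [v]; rewrite mul_mxrow => /eq_mxrowP vM.
exists v => i; apply/sub_kermxP; rewrite mulmxBl vM mulmxA subrr //.
Qed.

End Pencil.

End Layers.

(** * Syzygies, relations and dimension counts *)

Section PowerSpaces.
Variables (k : fieldType) (n d : nat).

(** The row space of [power_mx W] is the space W^n inside V^n. *)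
Definition power_mx (W : 'M[k]_d) : 'M[k]_(\sum_(j < n) d) := \mxdiag_j W.

Lemma power_mxP (W : 'M[k]_d) (w : 'rV_(\sum_(j < n) d)) :
  (w <= power_mx W)%MS <-> forall j, (submxrow w j <= W)%MS.
Proof.
split=> [/submxP [x ->] j|wW].
  by rewrite -(submxrowK x) mul_mxrow_mxdiag mxrowK submxMl.
have wj j : exists x, submxrow w j == x *m W by have /submxP [x ->] := wW j; exists x.
apply/submxP; exists (\mxrow_j xchoose (wj j)).
rewrite mul_mxrow_mxdiag -[LHS]submxrowK; apply: eq_mxrow => j.
exact/eqP/(xchooseP (wj j)).
Qed.

Lemma power_mx_mul m (W : 'M[k]_d) (A : 'I_n -> 'M[k]_(d, m)) :
  power_mx W *m \mxcol_j A j = \mxcol_j (W *m A j).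
Proof. exact: mul_mxdiag_mxcol. Qed.

Lemma mxcol_sub m p (q_ : 'I_n -> nat) (A : forall j, 'M[k]_(q_ j, m)) (B : 'M_(p, m)) :
  (\mxcol_j A j <= B)%MS <-> forall j, (A j <= B)%MS.
Proof.
rewrite eqmx_col; split=> [/sumsmx_subP AB j|AB].
  by rewrite -(genmxE (A j)) AB.
by apply/sumsmx_subP => j _; rewrite genmxE.
Qed.

Lemma sub_mxcol m (q_ : 'I_n -> nat) (A : forall j, 'M[k]_(q_ j, m)) j :
  (A j <= \mxcol_i A i)%MS.
Proof. by have /mxcol_sub := submx_refl (\mxcol_i A i); apply. Qed.

Lemma rank_power_mx (W : 'M[k]_d) : (\rank (power_mx W) = n * \rank W)%N.
Proof. by rewrite rank_mxdiag sum_nat_const card_ord. Qed.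

Lemma power_mx_count m (W : 'M[k]_d) (A : 'M[k]_(\sum_(j < n) d, m)) :
  (\rank (power_mx W *m A) + \rank (power_mx W :&: kermx A) = n * \rank W)%N.
Proof. by rewrite mxrank_mul_ker rank_power_mx. Qed.

End PowerSpaces.

Section Pencils.
Variables (k : closedFieldType) (n d : nat) (a : 'M[k]_n).
Hypothesis det_a : \det a != 0.
Implicit Types (M : tuples k n d) (v t : 'rV[k]_d) (u y : 'I_n -> 'rV[k]_d).

Let ua : a \in unitmx. Proof. by rewrite unitmxE unitfE. Qed.

(** In terms of the twisted tuple the relation reads sum M_i (twist M)_i = 0. *)
Definition twist M : tuples k n d := [ffun i => \sum_j a i j *: M j].

Lemma twistK M j : \sum_i invmx a j i *: twist M i = M j.
Proof.
under eq_bigr do rewrite ffunE scaler_sumr.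
rewrite exchange_big (bigD1 j) //= [X in _ + X]big1 => [|l lj].
  rewrite addr0 -[RHS]scale1r; have /matrixP/(_ j j) := mulVmx ua.
  rewrite !mxE eqxx mulr1n => <-; rewrite scaler_suml.
  by apply: eq_bigr => i _; rewrite scalerA.
have /matrixP/(_ j l) := mulVmx ua; rewrite !mxE eq_sym (negPf lj) mulr0n.
move=> e; rewrite -[RHS](scale0r (M l)) -e scaler_suml.
by apply: eq_bigr => i _; rewrite scalerA.
Qed.

Lemma relationE y M :
  \sum_i \sum_j a i j *: (y i *m M j) = \sum_i y i *m twist M i.
Proof.
apply: eq_bigr => i _; rewrite ffunE mulmx_sumr.
by apply: eq_bigr => j _; rewrite scalemxAr.
Qed.

(** As a is invertible, M and its twist generate the same products. *)
Lemma rad_twist M : (power_mx n <<rad_mx M>>%MS *m rad_mx (twist M) :=: rad2_mx M)%MS.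
Proof.
apply/eqmxP; rewrite power_mx_mul; apply/andP; split; apply/mxcol_sub => j.
  rewrite ffunE mulmx_sumr; apply: summx_sub => l _; rewrite -scalemxAr.
  by apply: scalemx_sub; apply: mul_sub_rad2; rewrite genmxE.
rewrite -(twistK M j) mulmx_sumr; apply: summx_sub => i _.
rewrite -scalemxAr; apply: scalemx_sub.
rewrite -(eqmxMr _ (genmxE _)).
exact: (sub_mxcol (fun i => <<rad_mx M>>%MS *m twist M i)).
Qed.

(** The relation of the algebra, restricted to Rad^n because the image Rad2 of
Rad^n, and so the dimension of the kernel, is known. *)
Definition relation_mx M : 'M[k]_(\sum_(j < n) d) :=
  (power_mx n <<rad_mx M>>%MS :&: kermx (rad_mx (twist M)))%MS.

Lemma relation_mxP M (w : 'rV_(\sum_(j < n) d)) : (w <= relation_mx M)%MS <->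
  (forall j, (submxrow w j <= rad_mx M)%MS) /\
  \sum_i submxrow w i *m twist M i = 0.
Proof.
rewrite sub_capmx; split=> [/andP [/power_mxP wR /sub_kermxP wM]|[wR wM]].
  split=> [j|]; first by rewrite -(genmxE (rad_mx M)).
  by rewrite -mul_rad_mx submxrowK.
apply/andP; split; first by apply/power_mxP => j; rewrite genmxE.
by apply/sub_kermxP; rewrite -(submxrowK w) mul_rad_mx.
Qed.

Lemma relation_count M :
  (\rank (rad2_mx M) + \rank (relation_mx M) = n * \rank (rad_mx M))%N.
Proof. by rewrite -(rad_twist M) power_mx_count genmxE. Qed.

(** The multiples lam_i t can be corrected by elements of Rad so as to satisfy the
relation, because the products Rad M_j span Rad2. *)
Lemma rad_lift M t (lam : 'I_n -> k) :
    ((\sum_i lam i *: (t *m twist M i))%R <= rad2_mx M)%MS ->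
  exists2 y, forall i, (y i - lam i *: t <= rad_mx M)%MS &
             \sum_i \sum_j a i j *: (y i *m M j) = 0.
Proof.
rewrite -(rad_twist M) => /submxP [w].
rewrite -(submxrowK w) power_mx_mul mul_mxrow_mxcol => defw.
exists (fun i => lam i *: t - submxrow w i *m <<rad_mx M>>%MS) => [i|].
  by rewrite addrAC subrr add0r eqmx_opp -(genmxE (rad_mx M)) submxMl.
rewrite relationE; under eq_bigr do rewrite mulmxBl -scalemxAl.
rewrite big_split /= defw sumrN; apply/eqP; rewrite subr_eq0; apply/eqP.
by apply: eq_bigr => i _; rewrite mulmxA.
Qed.

(** The rows (v M_j)_j that lie in soc^n are those with v in soc2. *)
Lemma act_soc_count M : rep_var a M ->
  (\rank (act_mx M + power_mx n (kermx (act_mx M)))%MS =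
   \rank (act2_mx M) + n * (d - \rank (act_mx M)))%N.
Proof.
move=> XM; set A := act_mx M; set B := power_mx n _; set A2 := act2_mx M.
have rB : \rank B = (n * (d - \rank A))%N.
  by rewrite rank_power_mx mxrank_ker.
have defAB : (A :&: B :=: kermx A2 *m A)%MS.
  apply/eqmxP/andP; split; apply/row_subP => i.
    have := row_sub i (A :&: B)%MS; rewrite sub_capmx.
    set w := row i _ => /andP [/submxP [v defw] /power_mxP wB].
    rewrite defw; apply: submxMr; apply/soc2P => j l.
    have := wB j; rewrite defw mul_act_mx mxrowK => /socP; exact.
  rewrite row_mul sub_capmx submxMl; apply/power_mxP => j.
  rewrite mul_act_mx mxrowK; apply/socP => l.
  by have /soc2P := row_sub i (kermx A2); apply.
have := mxrank_sum_cap A B; rewrite defAB.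
have := mxrank_mul_ker (kermx A2) A.
rewrite (capmx_idPr (soc_sub_soc2 XM)) !mxrank_ker rB.
have := mxrankS (soc_sub_soc2 XM); rewrite !mxrank_ker.
have := rank_leq_row A; have := rank_leq_row A2; rewrite -/A -/A2.
lia.
Qed.

Variable G : tuples k n d -> Prop.
Hypothesis genG : generic_class a G.

Lemma sub_mul0 m p (A : 'M[k]_(m, d)) (B : 'M[k]_(p, d)) (phi : 'cV_d) :
  (A <= B)%MS -> B *m phi = 0 -> A *m phi = 0.
Proof. by move=> /submxP [x ->] Bphi; rewrite -mulmxA Bphi mulmx0. Qed.

(** The pencil in the direction y_i = lam_i t + rad, with phi killing t, would put
sum_j lam_j phi(u_j) t into the radical.  The condition on lam makes the
obstruction sum a_ij lam_i alpha_j r to the choice of y vanish. *)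
Lemma pencil_syzygy M t (r : 'rV_d) (alpha lam : 'I_n -> k) (phi : 'cV_d) u : G M ->
    ~~ (t <= rad_mx M)%MS -> (t <= kermx (act2_mx M))%MS ->
    (forall j, (t *m M j - alpha j *: r <= rad2_mx M)%MS) ->
    rad_mx M *m phi = 0 -> t *m phi = 0 -> \sum_j u j *m M j = 0 ->
    \sum_i \sum_j a i j * lam i * alpha j = 0 ->
  \sum_j lam j * (u j *m phi) 0 0 = 0.
Proof.
move=> GM tR t2 tM Rphi tphi uM la.
have [|y yt ya] := @rad_lift M t lam.
  have -> : \sum_i lam i *: (t *m twist M i) =
      \sum_i \sum_j (a i j * lam i) *: (t *m M j - alpha j *: r).
    transitivity (\sum_i \sum_j (a i j * lam i) *: (t *m M j) -
                  (\sum_i \sum_j a i j * lam i * alpha j) *: r).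
      rewrite la scale0r subr0; apply: eq_bigr => i _.
      rewrite ffunE mulmx_sumr scaler_sumr; apply: eq_bigr => j _.
      by rewrite -scalemxAr scalerA mulrC.
    rewrite scaler_suml -sumrB; apply: eq_bigr => i _.
    rewrite scaler_suml -sumrB; apply: eq_bigr => j _.
    by rewrite scalerBr scalerA.
  by do 2!apply: summx_sub => ? _; apply: scalemx_sub.
have yphi i : y i *m phi = 0.
  rewrite -[y i](subrK (lam i *: t)) mulmxDl -scalemxAl tphi scaler0 addr0.
  exact: sub_mul0 (yt i) Rphi.
have XM := gen_rep genG GM.
have y2 i : (y i <= kermx (act2_mx M))%MS.
  rewrite -[y i](subrK (lam i *: t)); apply: addmx_sub; last exact: scalemx_sub.
  exact: submx_trans (yt i) (rad_sub_soc2 XM).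
have := pencil_rad genG GM Rphi yphi y2 ya uM.
set s := \sum_j (_ * _) => uy; apply: contraNeq tR => s0.
rewrite -(eqmx_scale _ s0) scaler_suml.
have -> : \sum_i (lam i * (u i *m phi) 0 0) *: t =
    \sum_j u j *m phi *m y j - \sum_j (u j *m phi) 0 0 *: (y j - lam j *: t).
  rewrite -sumrB; apply: eq_bigr => j _.
  rewrite {2}[u j *m phi]mx11_scalar mul_scalar_mx scalerBr subKr scalerA.
  by rewrite mulrC.
by rewrite addmx_sub // eqmx_opp; apply: summx_sub => j _; apply: scalemx_sub.
Qed.

(** For t in V outside Rad with all t M_j in Rad2, [pencil_syzygy] with r = 0 holds
for every lam and every phi killing Rad and t, so that all syzygies lie in
(Rad + t)^n; this space is mapped onto Rad2 by (u_j) |-> sum u_j M_j, whereas V^n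
is mapped onto Rad. *)
Lemma top_kernel_count M t : G M ->
    ~~ (t <= rad_mx M)%MS -> (forall j, (t *m M j <= rad2_mx M)%MS) ->
  (n * (\rank (rad_mx M)).+1 + \rank (rad_mx M) = n * d + \rank (rad2_mx M))%N.
Proof.
move=> GM tR tM; have XM := gen_rep genG GM.
pose W := (rad_mx M + t)%MS.
have syz u : \sum_j u j *m M j = 0 -> forall j, (u j <= W)%MS.
  move=> uM j; apply/idPn => /separate [phi Wphi]; apply/negP; rewrite negbK.
  have Rphi : rad_mx M *m phi = 0 by apply: sub_mul0 Wphi; exact: addsmxSl.
  have tphi : t *m phi = 0 by apply: sub_mul0 Wphi; exact: addsmxSr.
  have t2 : (t <= kermx (act2_mx M))%MS.
    apply/soc2P => i l; have /socP := submx_trans (tM i) (rad2_sub_soc XM); exact.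
  have : \sum_i (i == j)%:R * (u i *m phi) 0 0 = 0.
    apply: (pencil_syzygy (r := 0) (alpha := fun=> 0)) GM tR t2 _ Rphi tphi uM _.
      by move=> i; rewrite scaler0 subr0.
    by rewrite big1 // => i _; rewrite big1 // => l _; rewrite mulr0.
  rewrite (bigD1 j) //= eqxx mul1r big1 ?addr0 => [|i /negPf ->]; last by rewrite mul0r.
  by move=> uj; apply/eqP; rewrite [u j *m phi]mx11_scalar uj raddf0.
have kW : (kermx (rad_mx M) <= power_mx n W)%MS.
  apply/row_subP => i; apply/power_mxP; apply: syz.
  by rewrite -mul_rad_mx submxrowK; apply/sub_kermxP/row_sub.
have := power_mx_count W (rad_mx M); rewrite (capmx_idPr kW) mxrank_ker.
have -> : \rank (power_mx n W *m rad_mx M) = \rank (rad2_mx M).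
  apply: eqmx_rank; rewrite power_mx_mul.
  apply/andP; split; apply/mxcol_sub => j.
    rewrite addsmxMr addsmx_sub mul_sub_rad2 //=.
  apply: submx_trans (sub_mxcol (fun j => W *m M j) j).
  by apply: submxMr; exact: addsmxSl.
have -> : \rank W = (\rank (rad_mx M)).+1.
  have sW : (rad_mx M <= W)%MS by exact: addsmxSl.
  have ltW : (\rank (rad_mx M) < \rank W)%N.
    rewrite ltn_neqAle mxrankS // andbT (mxrank_leqif_sup sW).
    by apply: contra tR; apply: submx_trans; exact: addsmxSr.
  apply/eqP; rewrite eqn_leq ltW andbT.
  by apply: leq_trans (mxrank_adds_leqif _ _).1 _; have := rank_leq_row t; lia.
have := rank_leq_row (rad_mx M).
move: (\rank (rad_mx M)) (\rank (rad2_mx M)) => r1 r2.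
rewrite sum_nat_const card_ord; lia.
Qed.

(** Such a t spans a simple direct summand.  Deforming M so that t M_j becomes an
arbitrary relation y_j would shrink the socle, unless y is already of the form
(v M_j)_j. *)
Lemma simple_summand_count M t : G M ->
    (t <= kermx (act_mx M))%MS -> ~~ (t <= rad_mx M)%MS ->
  (n * \rank (rad_mx M) <= \rank (rad2_mx M) + \rank (act_mx M))%N.
Proof.
move=> GM ts /separate [phi Rphi tphi]; rewrite -relation_count leq_add2l.
apply: mxrankS; apply/row_subP => i.
have /relation_mxP [] := row_sub i (relation_mx M); set w := row i _ => wR wM.
have XM := gen_rep genG GM.
have [|||v vM] := @pencil_soc k n d a G genG M phi (submxrow w) GM Rphi _ _ _ t ts tphi.
- by move=> j; exact: sub_mul0 (wR j) Rphi.
- by move=> j; exact: submx_trans (wR j) (rad_sub_soc2 XM).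
- by rewrite relationE.
apply/submxP; exists v; rewrite mul_act_mx -[LHS]submxrowK.
by apply: eq_mxrow => j; rewrite vM.
Qed.

(** If soc2 / Rad has dimension at least two, choose phi vanishing at t but not on
soc2.  The pencil with y_i = lam_i t + rad would shrink soc2 unless y_i is
congruent to some v M_i modulo soc, hence lies in Rad, which means lam_i = 0. *)
Lemma soc2_layer_injective M t (lam : 'I_n -> k) : G M ->
    (kermx (act_mx M) <= rad_mx M)%MS ->
    (t <= kermx (act2_mx M))%MS -> ~~ (t <= rad_mx M)%MS ->
    (\rank (rad_mx M) + \rank (act2_mx M) + 2 <= d)%N ->
    ((\sum_i lam i *: (t *m twist M i))%R <= rad2_mx M)%MS ->
  forall i, lam i = 0.
Proof.
move=> GM sR t2 tR tau /rad_lift [y yt ya].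
have XM := gen_rep genG GM.
have /row_subPn [i0] : ~~ (kermx (act2_mx M) <= rad_mx M + t)%MS.
  apply/negP => /mxrankS; rewrite mxrank_ker.
  have := (mxrank_adds_leqif (rad_mx M) t).1; have := rank_leq_row t.
  lia.
have := row_sub i0 (kermx (act2_mx M)); set t' := row i0 _ => t'2.
move=> /separate [phi Wphi t'phi].
have Rphi : rad_mx M *m phi = 0 by apply: sub_mul0 Wphi; exact: addsmxSl.
have tphi : t *m phi = 0 by apply: sub_mul0 Wphi; exact: addsmxSr.
have [||v vy] := pencil_soc2 genG GM Rphi _ _ ya t'2 t'phi.
- move=> j; rewrite -[y j](subrK (lam j *: t)) mulmxDl -scalemxAl tphi scaler0 addr0.
  exact: sub_mul0 (yt j) Rphi.
- move=> j; rewrite -[y j](subrK (lam j *: t)); apply: addmx_sub; last exact: scalemx_sub.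
  exact: submx_trans (yt j) (rad_sub_soc2 XM).
move=> i; apply: contraNeq tR => li; rewrite -(eqmx_scale _ li).
have -> : lam i *: t = v *m M i - (v *m M i - y i) - (y i - lam i *: t).
  by rewrite !subKr.
rewrite !addmx_sub ?eqmx_opp ?mul_sub_rad //.
exact: submx_trans (vy i) sR.
Qed.

(** The elements (v M_i)_i and the elements of soc^n are relations. *)
Lemma relation_count_le M : rep_var a M -> (kermx (act_mx M) <= rad_mx M)%MS ->
  (\rank (rad2_mx M) + \rank (act2_mx M) + n * (d - \rank (act_mx M)) <=
   n * \rank (rad_mx M))%N.
Proof.
move=> XM sR; rewrite -addnA -act_soc_count // -relation_count leq_add2l.
apply: mxrankS; rewrite addsmx_sub; apply/andP; split; apply/row_subP => i.
  apply/relation_mxP; rewrite rowE mul_act_mx; split=> [j|].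
    by rewrite mxrowK mul_sub_rad.
  under eq_bigr do rewrite mxrowK.
  rewrite -relationE; case: XM => _ Ma.
  under eq_bigr do under eq_bigr do rewrite -mulmxA scalemxAr.
  by under eq_bigr do rewrite -mulmx_sumr; rewrite -mulmx_sumr Ma mulmx0.
have /power_mxP := row_sub i (power_mx n (kermx (act_mx M))).
set w := row i _ => ws; apply/relation_mxP; split=> [j|].
  exact: submx_trans (ws j) sR.
rewrite big1 // => j _; rewrite ffunE mulmx_sumr big1 // => l _.
by rewrite -scalemxAr; have /socP -> := ws j; rewrite scaler0.
Qed.

(** Conversely, if t in soc2 lies outside Rad, any relation y in Rad^n gives
a pencil with phi(t) <> 0, and [pencil_soc2] writes y as (v M_i)_i modulo soc^n. *)
Lemma relation_count_eq M t : G M -> (kermx (act_mx M) <= rad_mx M)%MS ->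
    (t <= kermx (act2_mx M))%MS -> ~~ (t <= rad_mx M)%MS ->
  (\rank (rad2_mx M) + \rank (act2_mx M) + n * (d - \rank (act_mx M)) =
   n * \rank (rad_mx M))%N.
Proof.
move=> GM sR t2 /separate [phi Rphi tphi]; have XM := gen_rep genG GM.
apply/eqP; rewrite eqn_leq relation_count_le //= -addnA -act_soc_count //.
rewrite -relation_count leq_add2l; apply: mxrankS; apply/row_subP => i.
have /relation_mxP [] := row_sub i (relation_mx M); set w := row i _ => wR wM.
have [|||v vM] := @pencil_soc2 k n d a G genG M phi (submxrow w) GM Rphi _ _ _ t t2 tphi.
- by move=> j; exact: sub_mul0 (wR j) Rphi.
- by move=> j; exact: submx_trans (wR j) (rad_sub_soc2 XM).
- by rewrite relationE.
rewrite -[w](subKr (v *m act_mx M)) addmx_sub_adds ?submxMl // eqmx_opp.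
apply/power_mxP => j; rewrite submxrowB mul_act_mx mxrowK; exact: vM.
Qed.

End Pencils.

(** * Duality *)

Section Transpose.
Variables (k : closedFieldType) (n d : nat).
Implicit Types (M E : tuples k n d) (a : 'M[k]_n).

Definition tr_tuple M : tuples k n d := [ffun j => (M j)^T].

Lemma tr_tupleK : involutive tr_tuple.
Proof. by move=> M; apply/ffunP => j; rewrite !ffunE trmxK. Qed.

Lemma tr_tuple_line M E e : tr_tuple (M + e *: E) = tr_tuple M + e *: tr_tuple E.
Proof. by apply/ffunP => j; rewrite !ffunE linearD linearZ. Qed.

Lemma act_tr M : act_mx (tr_tuple M) = (rad_mx M)^T.
Proof. by rewrite tr_mxcol; apply: eq_mxrow => j; rewrite ffunE. Qed.

Lemma rad_tr M : rad_mx (tr_tuple M) = (act_mx M)^T.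
Proof. by rewrite -[M in RHS]tr_tupleK act_tr trmxK. Qed.

Lemma act2_tr M : act2_mx (tr_tuple M) = (rad2_mx M)^T.
Proof.
by rewrite tr_mxcol; apply: eq_mxrow => j; rewrite act_tr ffunE trmx_mul.
Qed.

Lemma rad2_tr M : rad2_mx (tr_tuple M) = (act2_mx M)^T.
Proof. by rewrite -[M in RHS]tr_tupleK act2_tr trmxK. Qed.

Lemma rep_var_tr a M : rep_var a M -> rep_var a^T (tr_tuple M).
Proof.
move=> [M3 Ma]; split=> [i j l|].
  by rewrite !ffunE -!trmx_mul mulmxA M3 trmx0.
transitivity (\sum_i \sum_j a i j *: (M i *m M j))^T; last by rewrite Ma trmx0.
rewrite exchange_big raddf_sum; apply: eq_bigr => i _ /=.
rewrite raddf_sum; apply: eq_bigr => j _ /=.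
by rewrite !ffunE -trmx_mul mxE linearZ.
Qed.

Lemma generic_class_tr a G :
  generic_class a G -> generic_class a^T (fun M => G (tr_tuple M)).
Proof.
move=> genG; split=> [M|M E GM EM|M M' GM GM'].
- by move/(gen_rep genG)/rep_var_tr; rewrite tr_tupleK.
- have [e|q q0 Gq] := gen_line (E := tr_tuple E) genG GM.
    by rewrite -tr_tuple_line -[a]trmxK; apply: rep_var_tr.
  by exists q => // e qe; rewrite tr_tuple_line; apply: Gq.
- move: (gen_ranks genG GM GM'); rewrite /layer_ranks.
  rewrite !rad_tr !rad2_tr !act_tr !act2_tr !mxrank_tr.
  by case=> -> -> -> ->.
Qed.

(** The condition soc <= Rad is self-dual: the annihilators of soc and Rad are the
radical and the socle of the dual module. *)
Lemma soc_sub_rad_tr M : (kermx (act_mx M) <= rad_mx M)%MS ->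
  (kermx (act_mx (tr_tuple M)) <= rad_mx (tr_tuple M))%MS.
Proof.
rewrite act_tr rad_tr => /submxP [D defD].
set A := act_mx M in defD *; set B := rad_mx M in defD *.
have AK : (A^T <= kermx (kermx A)^T)%MS.
  by apply/sub_kermxP; rewrite -trmx_mul mulmx_ker trmx0.
have rK : \rank (kermx (kermx A)^T) = \rank A^T.
  by rewrite mxrank_ker !mxrank_tr mxrank_ker subKn // rank_leq_row.
have : (kermx (kermx A)^T <= A^T)%MS by rewrite -(mxrank_leqif_sup AK) rK.
apply: submx_trans; apply/sub_kermxP.
by rewrite defD trmx_mul mulmxA mulmx_ker mul0mx.
Qed.

End Transpose.

(** * Classification of the generic layers *)

(** A pencil of square matrices is singular for some parameter because k is
algebraically closed; a matrix with fewer columns than rows is made square by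
adding zero columns. *)
Lemma pencil_kernel (k : closedFieldType) m p (A B : 'M[k]_(m, p)) :
    (0 < m)%N -> (p <= m)%N ->
  exists (t : 'rV_m) (c0 c1 : k),
    [/\ t != 0, (c0 != 0) || (c1 != 0) & t *m (c0 *: A + c1 *: B) = 0].
Proof.
move=> m0 pm; pose J : 'M[k]_(p, m) := pid_mx p.
have JK : J *m (pid_mx p : 'M_(m, p)) = 1%:M by rewrite pid_mx_id // pid_mx_1.
suff [t [c0 [c1 [t0 c01 tc]]]] : exists (t : 'rV_m) (c0 c1 : k),
    [/\ t != 0, (c0 != 0) || (c1 != 0) & t *m (c0 *: (A *m J) + c1 *: (B *m J)) = 0].
  exists t, c0, c1; split => //; rewrite -[X in t *m X]mulmx1 -JK mulmxA mulmxA.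
  rewrite -(mulmxA t) mulmxDl -!scalemxAl -[LHS]mulmxA.
  by rewrite [LHS]mulmxA tc mul0mx.
have [AJ|AJ] := boolP (A *m J \in unitmx).
  have /closed_rootP [c] : size (char_poly (B *m J *m invmx (A *m J))) != 1%N.
    by rewrite size_char_poly -lt0n.
  rewrite -eigenvalue_root_char => /eigenvalueP [t tc t0].
  exists t, (- c), 1; split; rewrite ?oner_eq0 ?orbT //.
  rewrite scale1r mulmxDr -scalemxAr; apply/eqP; rewrite addrC scaleNr subr_eq0.
  by apply/eqP; rewrite scalemxAl -tc -!(mulmxA t) mulmxKV.
have : kermx (A *m J) != 0.
  by rewrite kermx_eq0 -row_free_unit in AJ *.
move/rowV0Pn => [t /sub_kermxP tA t0].
by exists t, 1, 0; split; rewrite ?oner_eq0 // scale1r scale0r addr0.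
Qed.

Section Core.
Variables (k : closedFieldType) (n d : nat) (a : 'M[k]_n).
Hypotheses (det_a : \det a != 0) (n_gt1 : (1 < n)%N).
Implicit Types (M : tuples k n d) (v t : 'rV[k]_d) (u y : 'I_n -> 'rV[k]_d).

Lemma exists_other (i : 'I_n) : exists j, j != i.
Proof.
pose i0 := Ordinal (ltnW n_gt1).
have [->|i_neq] := eqVneq i i0; first by exists (Ordinal n_gt1).
by exists i0; rewrite eq_sym.
Qed.

(** Two of the maps soc2 / Rad -> soc / Rad2 given by the twisted generators form
a pencil, to which [pencil_kernel] applies when tau >= nu. *)
Lemma soc2_layer_degenerate M : rep_var a M ->
    (\rank (rad_mx M) + \rank (act2_mx M) < d)%N ->
    (d - \rank (act_mx M) - \rank (rad2_mx M) <=
     d - \rank (act2_mx M) - \rank (rad_mx M))%N ->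
  exists t (lam : 'I_n -> k) i,
    [/\ (t <= kermx (act2_mx M))%MS, ~~ (t <= rad_mx M)%MS, lam i != 0 &
        ((\sum_i lam i *: (t *m twist a M i))%R <= rad2_mx M)%MS].
Proof.
move=> XM tau_gt0 nu_le_tau.
pose S := (kermx (act2_mx M) :\: rad_mx M)%MS.
have rS : \rank S = (d - \rank (act2_mx M) - \rank (rad_mx M))%N.
  have := mxrank_cap_compl (kermx (act2_mx M)) (rad_mx M).
  rewrite (capmx_idPr (rad_sub_soc2 XM)) mxrank_ker; rewrite -/S; lia.
pose P := cokermx (rad2_mx M); pose W := kermx (act_mx M) *m P.
have rW : (\rank W <= \rank S)%N.
  rewrite rS; apply: leq_trans nu_le_tau.
  have := mxrank_mul_ker (kermx (act_mx M)) P.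
  have : (rad2_mx M <= kermx (act_mx M) :&: kermx P)%MS.
    by rewrite sub_capmx (rad2_sub_soc XM); apply/sub_kermxP/mulmx_coker.
  move/mxrankS; rewrite mxrank_ker; rewrite -/W; lia.
pose A i := row_base S *m twist a M i *m P *m pinvmx (row_base W).
have AW i : A i *m row_base W = row_base S *m twist a M i *m P.
  rewrite mulmxKpV // eq_row_base submxMr //; apply/row_subP => l.
  apply/socP => j; rewrite row_mul ffunE mulmx_sumr mulmx_suml.
  have /soc2P Sl : (row l (row_base S) <= kermx (act2_mx M))%MS.
    apply: submx_trans (row_sub _ _) _; rewrite eq_row_base; exact: diffmxSl.
  by rewrite big1 // => l' _; rewrite -scalemxAr -scalemxAl Sl scaler0.
pose i0 := Ordinal (ltnW n_gt1); pose i1 := Ordinal n_gt1.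
have S_gt0 : (0 < \rank S)%N by rewrite rS; lia.
have [t [c0 [c1 [t0 c01 tc]]]] := pencil_kernel (A i0) (A i1) S_gt0 rW.
pose lam i := if i == i0 then c0 else if i == i1 then c1 else 0.
exists (t *m row_base S), lam, (if c0 != 0 then i0 else i1); split.
- apply: mulmx_sub; rewrite eq_row_base; exact: diffmxSl.
- apply: contra t0 => tR; rewrite -(mulmx_free_eq0 _ (row_base_free S)).
  rewrite -submx0 -(capmx_diff (kermx (act2_mx M)) (rad_mx M)) sub_capmx tR.
  by rewrite mulmx_sub // eq_row_base.
- by rewrite /lam; case c0n: (c0 != 0) c01 => //= c1n; rewrite ?eqxx ?c0n.
rewrite submxE -/P (bigD1 i0) //= (bigD1 i1) //= big1 => [|i /andP [ni0 ni1]].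
  have tAW i : t *m row_base S *m twist a M i *m P = t *m A i *m row_base W.
    by rewrite -(mulmxA t (A i)) AW !mulmxA.
  rewrite /lam !eqxx addr0 mulmxDl -!scalemxAl !tAW /=.
  rewrite (scalemxAl _ (t *m A i0)) (scalemxAl _ (t *m A i1)) -mulmxDl.
  by move: tc; rewrite mulmxDr -!scalemxAr => ->; rewrite mul0mx.
by rewrite /lam (negPf ni0) (negPf ni1) scale0r.
Qed.

Variable G : tuples k n d -> Prop.
Hypothesis genG : generic_class a G.

Lemma layer_growth M : G M -> (kermx (act_mx M) <= rad_mx M)%MS ->
    (\rank (rad_mx M) + \rank (act2_mx M) + 2 <= d)%N ->
  (d - \rank (act2_mx M) - \rank (rad_mx M) <
   d - \rank (act_mx M) - \rank (rad2_mx M))%N.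
Proof.
move=> GM sR tau; rewrite ltnNge; apply/negP => nu_le_tau.
have [|t [lam [i [t2 tR li tl]]]] := soc2_layer_degenerate (gen_rep genG GM) _ nu_le_tau.
  by lia.
by have := soc2_layer_injective det_a genG GM sR t2 tR tau tl i; apply/eqP.
Qed.

(** A vector t of the socle outside Rad falls under both [top_kernel_count] and
[simple_summand_count].  With x = d - 1 - r1 these give n x <= r1 and
(n - 1) r1 <= x, which forces r1 = x = 0. *)
Lemma soc_sub_rad M : G M -> ~ (d = 1 /\ \rank (rad_mx M) = 0)%N ->
  (kermx (act_mx M) <= rad_mx M)%MS.
Proof.
move=> GM not_simple; apply/row_subP => i; apply: contra_notT not_simple.
have ts := row_sub i (kermx (act_mx M)); move: (row i _) ts => t ts tR.
have cS := simple_summand_count det_a genG GM ts tR.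
have cK : (n * (\rank (rad_mx M)).+1 + \rank (rad_mx M) = n * d + \rank (rad2_mx M))%N.
  apply: (top_kernel_count det_a genG GM tR) => j.
  by have /socP -> := ts; rewrite sub0mx.
have : (\rank (rad2_mx M) < \rank (kermx (act_mx M)))%N.
  have s2 := rad2_sub_soc (gen_rep genG GM).
  rewrite ltn_neqAle mxrankS // andbT (mxrank_leqif_sup s2).
  apply: contra tR => /(submx_trans ts) /submx_trans; apply; exact: rad2_sub_rad.
rewrite mxrank_ker => s1.
have := mxrankS (rad2_sub_rad M).
nia.
Qed.

(** Suppose some u_i0 is not in soc2, and let phi1 vanish on soc2 and not at u_i0.
With t M_j = alpha_j r modulo Rad2 and alpha <> 0, u can be corrected to a syzygy
without changing the phi1(u_j), and [pencil_syzygy] says that (phi1(u_j))_j is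
a multiple of a alpha.  But M can be replaced by M_j + e phi c_j r, which leaves
Rad2 and soc2 unchanged and translates alpha in the direction c; as n > 1, some
choice of c and e makes a alpha independent of (phi1(u_j))_j. *)
Lemma syzygy_soc2 M t (r : 'rV_d) u : G M -> (kermx (act_mx M) <= rad_mx M)%MS ->
    (t <= kermx (act2_mx M))%MS -> ~~ (t <= rad_mx M)%MS ->
    (r <= kermx (act_mx M))%MS -> (kermx (act_mx M) <= rad2_mx M + r)%MS ->
    ((\sum_j u j *m M j)%R <= kermx (act_mx M))%MS ->
  forall i, (u i <= kermx (act2_mx M))%MS.
Proof.
move=> GM sR t2 tR rs sr us i0; have XM := gen_rep genG GM.
apply/idPn => /separate [phi1 S2phi1 uphi1].
have [i1 i10] := exists_other i0.
have decomp v : (v <= kermx (act_mx M))%MS ->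
    exists b : k, (v - b *: r <= rad2_mx M)%MS.
  move=> vs; have /sub_addsmxP [[x y] /= ->] := submx_trans vs sr.
  exists (y 0 0); rewrite [y in y *m r]mx11_scalar mul_scalar_mx addrK.
  exact: submxMl.
have [alpha talpha] : exists alpha : 'I_n -> k,
    forall j, (t *m M j - alpha j *: r <= rad2_mx M)%MS.
  apply: (@fin_all_exists _ (fun=> k) (fun j c => (t *m M j - c *: r <= rad2_mx M)%MS)) => j.
  by apply: decomp; apply/socP => l; have /soc2P := t2; apply.
have [beta ubeta] := decomp _ us.
have [phi Rphi tphi] := separate tR.
have Mphi := (rad_annihilator M phi).1 Rphi.
have Rphi1 : rad_mx M *m phi1 = 0 by exact: sub_mul0 (rad_sub_soc2 XM) S2phi1.
have tphi1 : t *m phi1 = 0 by exact: sub_mul0 t2 S2phi1.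
have rphi1 : r *m phi1 = 0 by exact: sub_mul0 (submx_trans rs sR) Rphi1.
have rphi : r *m phi = 0 by exact: sub_mul0 (submx_trans rs sR) Rphi.
have rM j : r *m M j = 0 by have /socP := rs; apply.
pose s := (t *m phi) 0 0.
have s0 : s != 0.
  by apply: contra_neq tphi => ts; rewrite [t *m phi]mx11_scalar -/s ts raddf0.
pose mu j := (u j *m phi1) 0 0.
have mu0 : mu i0 != 0.
  by apply: contra_neq uphi1 => ts; rewrite [u i0 *m _]mx11_scalar -/(mu i0) ts raddf0.
(* This c moves a alpha in the direction of the basis vector of index i1. *)
pose c j := invmx a j i1.
pose y j := c j *: r.
have yphi j : y j *m phi = 0 by rewrite -scalemxAl rphi scaler0.
have yM i j : y i *m M j = 0 by rewrite -scalemxAl rM scaler0.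
have y2 j : (y j <= kermx (act2_mx M))%MS.
  by apply/soc2P => i l; rewrite yM mul0mx.
have ya : \sum_i \sum_j a i j *: (y i *m M j) = 0.
  by rewrite big1 // => i _; rewrite big1 // => j _; rewrite yM scaler0.
have [q q0 Gq] := gen_line genG GM (pencil_line genG GM Rphi yphi y2 ya).
pose gamma i := \sum_j a i j * alpha j.
(* At e, this is the minor of a alpha' and mu in the rows i1 and i0. *)
pose p := (s * mu i0)%:P * 'X + (gamma i1 * mu i0 - gamma i0 * mu i1)%:P.
have p0 : p != 0.
  apply: contraNneq (mulf_neq0 s0 mu0) => p0.
  have := congr1 (fun p : {poly k} => p`_1) p0.
  by rewrite coefD coefMX coefC /= coefC addr0 coef0 => ->.
have /nonrootP [e] : q * p != 0 by rewrite mulf_neq0.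
rewrite hornerM mulf_eq0 negb_or => /andP [/Gq GM' pe].
set M' := M + e *: rank_one phi y in GM'.
have MM' i j : M' i *m M' j = M i *m M j.
  by rewrite pencil_mul // yM mulmx0 scaler0 addr0.
have rad2M' : rad2_mx M' = rad2_mx M.
  by rewrite !rad2_mxE; apply: eq_mxcol => j; apply: eq_mxcol => i.
have act2M' : act2_mx M' = act2_mx M.
  by rewrite !act2_mxE; apply: eq_mxrow => j; apply: eq_mxrow => i.
have radM' : (rad_mx M' <= rad_mx M)%MS.
  apply/mxcol_sub => j; rewrite !ffunE addmx_sub //; first exact: sub_mxcol.
  rewrite scalemx_sub // -scalemxAr scalemx_sub // mulmx_sub //.
  exact: submx_trans rs sR.
pose alpha' j := alpha j + e * s * c j.
have actM' v j : v *m M' j = v *m M j + (e * (v *m phi) 0 0 * c j) *: r.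
  rewrite !ffunE mulmxDr -scalemxAr mulmxA {1}[v *m phi]mx11_scalar mul_scalar_mx.
  by rewrite !scalerA.
have talpha' j : (t *m M' j - alpha' j *: r <= rad2_mx M')%MS.
  by rewrite rad2M' actM' scalerDl opprD addrACA subrr addr0.
have gamma' i : \sum_j a i j * alpha' j = gamma i + e * s * (i == i1)%:R.
  have -> : (i == i1)%:R = \sum_j a i j * c j.
    have /matrixP/(_ i i1) : a *m invmx a = 1%:M by rewrite mulmxV // unitmxE unitfE.
    by rewrite !mxE.
  rewrite mulr_sumr -big_split; apply: eq_bigr => j _ /=.
  by rewrite mulrDr; congr (_ + _); ring.
(* Orthogonal to a alpha', and not to mu by the choice of e. *)
pose lam i := if i == i0 then gamma i1 + e * s else if i == i1 then - gamma i0 else 0.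
have sum_lam (f : 'I_n -> k) : \sum_i lam i * f i = (gamma i1 + e * s) * f i0 - gamma i0 * f i1.
  rewrite (bigD1 i0) //= (bigD1 i1) //= big1 => [|i /andP [/negPf ni0 /negPf ni1]].
    by rewrite /lam !eqxx (negPf i10) addr0 mulNr.
  by rewrite /lam ni0 ni1 mul0r.
have lam_mu : \sum_j lam j * mu j != 0.
  apply: contraNneq pe => lm; rewrite -lm sum_lam /p hornerD hornerM !hornerC hornerX; apply/eqP; ring.
have lam_gamma : \sum_i \sum_j a i j * lam i * alpha' j = 0.
  transitivity (\sum_i lam i * \sum_j a i j * alpha' j).
    by apply: eq_bigr => i _; rewrite mulr_sumr; apply: eq_bigr => j _; ring.
  rewrite sum_lam !gamma' eqxx [i0 == i1]eq_sym (negPf i10) mulr1n mulr0n.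
  by rewrite mulr1 mulr0 addr0 mulrC subrr.
have [j1 alpha1] : exists j, alpha' j != 0.
  apply/existsP; apply: contraNT lam_mu; rewrite negb_exists => /forallP al0.
  have gam0 i : gamma i + e * s * (i == i1)%:R = 0.
    by rewrite -gamma' big1 // => j _; rewrite (eqP (negbNE (al0 j))) mulr0.
  have := gam0 i0; have := gam0 i1; rewrite eqxx eq_sym (negPf i10) mulr1 mulr0 addr0.
  by move=> g1 g0; rewrite sum_lam g1 g0 !mul0r subrr.
have [beta' ubeta'] : exists b, ((\sum_j u j *m M' j)%R - b *: r <= rad2_mx M')%MS.
  exists (beta + \sum_j e * (u j *m phi) 0 0 * c j).
  have -> : \sum_j u j *m M' j =
      \sum_j u j *m M j + (\sum_j e * (u j *m phi) 0 0 * c j) *: r.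
    by rewrite scaler_suml -big_split; apply: eq_bigr => j _; exact: actM'.
  by rewrite scalerDl opprD addrACA subrr addr0 rad2M'.
(* Correct u by a multiple of t at j1 and by elements of Rad to a syzygy. *)
pose b := beta' / alpha' j1.
have : ((\sum_j u j *m M' j)%R - b *: (t *m M' j1) <= rad2_mx M')%MS.
  have -> : \sum_j u j *m M' j - b *: (t *m M' j1) =
     (\sum_j u j *m M' j - beta' *: r) - b *: (t *m M' j1 - alpha' j1 *: r).
    by rewrite scalerBr scalerA divfK // opprB addrA subrK.
  by rewrite addmx_sub // eqmx_opp scalemx_sub.
move=> /rad2P [x xR defx].
pose u' j := u j - (if j == j1 then b *: t else 0) - x j.
have u'M' : \sum_j u' j *m M' j = 0.
  transitivity (\sum_j u j *m M' j -
    \sum_j (if j == j1 then b *: t else 0) *m M' j - \sum_j x j *m M' j).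
    by rewrite -!sumrB; apply: eq_bigr => j _; rewrite !mulmxBl.
  have -> : \sum_j (if j == j1 then b *: t else 0) *m M' j = b *: (t *m M' j1).
    rewrite (bigD1 j1) //= eqxx big1 ?addr0 ?scalemxAl // => j /negPf ->.
    by rewrite mul0mx.
  by rewrite defx subrr.
have u'phi j : (u' j *m phi1) 0 0 = mu j.
  rewrite !mulmxBl; have -> : x j *m phi1 = 0.
    by apply: sub_mul0 (submx_trans (xR j) radM') Rphi1.
  case: ifP => _; last by rewrite mul0mx !subr0.
  by rewrite -scalemxAl tphi1 scaler0 !subr0.
have tR' : ~~ (t <= rad_mx M')%MS by apply: contra tR => /submx_trans; apply.
have t2' : (t <= kermx (act2_mx M'))%MS by rewrite act2M'.
have Rphi1' : rad_mx M' *m phi1 = 0 by exact: sub_mul0 radM' Rphi1.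
have := pencil_syzygy det_a genG GM' tR' t2' talpha' Rphi1' tphi1 u'M' lam_gamma.
by under eq_bigr do rewrite u'phi; move/eqP; apply/negP.
Qed.

(** Compare (soc2)^n with the kernel of V^n -> Rad / soc. *)
Lemma syzygy_count M t (r : 'rV_d) : G M -> (kermx (act_mx M) <= rad_mx M)%MS ->
    (t <= kermx (act2_mx M))%MS -> ~~ (t <= rad_mx M)%MS ->
    (r <= kermx (act_mx M))%MS -> (kermx (act_mx M) <= rad2_mx M + r)%MS ->
  (n * \rank (act2_mx M) + (d - \rank (act_mx M)) <= \rank (rad_mx M))%N.
Proof.
move=> GM sR t2 tR rs sr.
have : (kermx (rad_mx M *m act_mx M) <= power_mx n (kermx (act2_mx M)))%MS.
  apply/row_subP => i; apply/power_mxP.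
  apply: (syzygy_soc2 GM sR t2 tR rs sr).
  rewrite -mul_rad_mx submxrowK; apply/sub_kermxP; rewrite -mulmxA.
  exact/sub_kermxP/row_sub.
move/mxrankS; rewrite mxrank_ker rank_power_mx mxrank_ker.
have := mxrank_mul_ker (rad_mx M) (act_mx M).
rewrite (capmx_idPr sR) mxrank_ker.
have := mxrankM_maxl (rad_mx M) (act_mx M).
move: (\rank (_ *m _)) (rank_leq_row (rad_mx M)) (rank_leq_row (act2_mx M)) => p.
move: (rank_leq_row (act_mx M)).
move: (\rank (rad_mx M)) (\rank (act2_mx M)) (\rank (act_mx M)) => r1 c2 c1 h1 h2 h3.
rewrite sum_nat_const card_ord.
nia.
Qed.

Lemma rad_rank_bound M :
  (\rank (rad_mx M) <= n * \rank (rad2_mx M) + (d - \rank (act_mx M)))%N.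
Proof.
rewrite -(mxrank_mul_ker (rad_mx M) (act_mx M)) leq_add //; last first.
  by rewrite -mxrank_ker mxrankS // capmxSr.
have -> : (n * \rank (rad2_mx M) = \rank (power_mx n <<rad2_mx M>>%MS))%N.
  by rewrite rank_power_mx genmxE.
apply: mxrankS; apply/row_subP => i; apply/power_mxP => j.
by rewrite genmxE row_mul mul_act_mx mxrowK mul_sub_rad2 // row_sub.
Qed.

(** What genericity says about the four ranks alone: r1, r2 are the dimensions of
Rad, Rad2 and c1, c2 the codimensions of soc, soc2, so that tau = d - c2 - r1 and
nu = d - c1 - r2. *)
Record layer_bounds (r1 r2 c1 c2 : nat) : Prop := LayerBounds {
  lb_order : [/\ r2 <= r1, c1 <= d, c1 + r2 <= d & c2 + r1 <= d]%N;
  lb_growth : (r1 + c2 + 2 <= d -> d - c2 - r1 < d - c1 - r2)%N;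
  lb_relation : (r2 + c2 + n * (d - c1) <= n * r1)%N;
  lb_relation_eq : (c2 + r1 < d -> r2 + c2 + n * (d - c1) = n * r1)%N;
  lb_free : (c2 + r1 < d -> c1 + r2 = d -> n * r1.+1 + r1 = n * d + r2)%N;
  lb_syzygy : (c2 + r1 < d -> c1 + r2 + 1 = d -> n * c2 + (d - c1) <= r1)%N;
  lb_rad : (r1 <= n * r2 + (d - c1))%N }.

Lemma layer_boundsP M : G M -> (kermx (act_mx M) <= rad_mx M)%MS ->
  layer_bounds (\rank (rad_mx M)) (\rank (rad2_mx M))
               (\rank (act_mx M)) (\rank (act2_mx M)).
Proof.
move=> GM sR; have XM := gen_rep genG GM.
have rad_rank_soc2 : (\rank (act2_mx M) + \rank (rad_mx M) < d)%N ->
    exists2 t : 'rV_d, (t <= kermx (act2_mx M))%MS & ~~ (t <= rad_mx M)%MS.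
  move=> tau; have /row_subPn [i tR] : ~~ (kermx (act2_mx M) <= rad_mx M)%MS.
    by apply/negP => /mxrankS; rewrite mxrank_ker; lia.
  by exists (row i (kermx (act2_mx M))) => //; exact: row_sub.
have r2s := mxrankS (rad2_sub_soc XM); rewrite mxrank_ker in r2s.
have r1s := mxrankS (rad_sub_soc2 XM); rewrite mxrank_ker in r1s.
have c1d := rank_leq_row (act_mx M); have c2d := rank_leq_row (act2_mx M).
have r12 := mxrankS (rad2_sub_rad M).
split.
- split=> //; lia.
- by move=> tau; apply: layer_growth.
- exact: (relation_count_le det_a XM sR).
- by move/rad_rank_soc2 => [t t2 tR]; exact: (relation_count_eq det_a genG GM sR t2 tR).
- move=> /rad_rank_soc2 [t t2 tR] nu0.
  apply: (top_kernel_count det_a genG GM tR) => j.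
  have sR2 : (kermx (act_mx M) <= rad2_mx M)%MS.
    rewrite -(mxrank_leqif_sup (rad2_sub_soc XM)) mxrank_ker; lia.
  by apply: submx_trans sR2; apply/socP => l; have /soc2P := t2; apply.
- move=> /rad_rank_soc2 [t t2 tR] nu1.
  have /row_subPn [i] : ~~ (kermx (act_mx M) <= rad2_mx M)%MS.
    by apply/negP => /mxrankS; rewrite mxrank_ker; lia.
  have := row_sub i (kermx (act_mx M)); move: (row i _) => r rs rR2.
  apply: (syzygy_count GM sR t2 tR rs).
  have sW : (rad2_mx M + r <= kermx (act_mx M))%MS.
    by rewrite addsmx_sub rs (rad2_sub_soc XM).
  rewrite -(mxrank_leqif_sup sW) eqn_leq mxrankS //= mxrank_ker.
  have : (\rank (rad2_mx M) < \rank (rad2_mx M + r)%MS)%N.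
    rewrite ltn_neqAle mxrankS ?addsmxSl // andbT mxrank_leqif_sup ?addsmxSl //.
    by apply: contra rR2; apply: submx_trans; exact: addsmxSr.
  move: nu1; move: (\rank (rad2_mx M + r)%MS) (\rank (rad2_mx M)) (\rank (act_mx M)) => x y z; lia.
- exact: rad_rank_bound.
Qed.

End Core.

(** In the row module: radical layering (b, n (b - 1), (n^2 - 1) (b - 1)) and socle
layering ((n^2 - 1) (b - 1), n (b - 1) + 1, b - 1). *)
Definition exceptional_ranks (n d r1 r2 c1 c2 : nat) : Prop :=
  exists2 b, (0 < b)%N &
    [/\ d = r1 + b, r1 = r2 + n * (b - 1), r2 = (n ^ 2 - 1) * (b - 1)
      & [/\ d = c1 + r2, c1 = c2 + (n * (b - 1) + 1) & c2 = b - 1]]%N.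

(** The two layerings are reverse to each other; the inequalities tell this case
from the exceptional ones. *)
Definition dual_ranks (n d r1 r2 c1 c2 : nat) : Prop :=
  [/\ d = c1 + r2, d = c2 + r1, r2 <= r1, r2 + c2 <= n * (r1 - r2)
    & r1 - r2 <= n * c2]%N.

Lemma layer_trichotomy_arith n d r1 r2 c1 c2 : (1 < n)%N ->
    layer_bounds n d r1 r2 c1 c2 -> layer_bounds n d c1 c2 r1 r2 ->
    ~ (d = 2 /\ r1 = 1 /\ r2 = 0)%N ->
  [\/ dual_ranks n d r1 r2 c1 c2, exceptional_ranks n d r1 r2 c1 c2
    | exceptional_ranks n d c1 c2 r1 r2].
Proof.
move=> n1 [[o1 o2 o3 o4] g rl re fr sy ra] [[o1' o2' o3' o4'] g' rl' re' fr' sy' ra'].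
rewrite ?(addnC r2 c1) ?(addnC r1 c2) in re' fr' sy'.
move=> not_uniserial.
have tau1 : (d <= r1 + c2 + 1)%N.
  rewrite leqNgt; apply/negP => h.
  have h1 : (r1 + c2 + 2 <= d)%N by clear - h; lia.
  have {}g := g h1.
  have h2 : (c1 + r2 + 2 <= d)%N by clear - g h1; lia.
  by have := g' h2; clear - g; lia.
have nu1 : (d <= c1 + r2 + 1)%N.
  rewrite leqNgt; apply/negP => h.
  have h1 : (c1 + r2 + 2 <= d)%N by clear - h; lia.
  have {}g' := g' h1.
  have h2 : (r1 + c2 + 2 <= d)%N by clear - g' h1; lia.
  by have := g h2; clear - g'; lia.
clear g g'.
have [tau|tau] := ltnP (c2 + r1) d; have [nu|nu] := ltnP (c1 + r2) d.
(* tau = nu = 1: with x = r1 - r2 - 1 one has n x = r2 + c2 and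
   n r2, n c2 <= x, so that x = 0. *)
- have h3 := re tau.
  have e1 : (c1 + r2 + 1 = d)%N by clear - nu nu1; lia.
  have e2 : (c2 + r1 + 1 = d)%N by clear - tau tau1; lia.
  have {sy tau} h1 := sy tau e1; have {sy' nu} h2 := sy' nu e2.
  clear - h1 h2 h3 e1 e2 n1 o1 o1' not_uniserial.
  have dc : (d - c1 = r2 + 1)%N by clear - e1; lia.
  have r21 : (r2 + 1 <= r1)%N by move: h1; rewrite dc; clear; lia.
  have [x defx] : exists x, r1 = (r2 + 1 + x)%N.
    by exists (r1 - (r2 + 1))%N; clear - r21; lia.
  have {}h1 : (n * c2 <= x)%N by move: h1; rewrite dc defx; clear; lia.
  have {}h2 : (n * r2 <= x)%N by move: h2; clear - defx e1 e2; lia.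
  have nx : (n * x = r2 + c2)%N by move: h3; rewrite dc defx !mulnDr; lia.
  have n2 : (2 * (r2 + c2) <= n * (r2 + c2))%N by rewrite leq_mul2r n1 orbT.
  have nx2 : (2 * x <= n * x)%N by rewrite leq_mul2r n1 orbT.
  have x0 : x = 0%N by move: n2; rewrite mulnDr; lia.
  by case: not_uniserial; lia.
- have e1 : (c1 + r2 = d)%N by clear - nu o3; lia.
  have {}fr := fr tau e1; have {}re := re tau.
  have [b defb] : exists b, d = (r1 + b.+1)%N.
    by exists (d - r1).-1; clear - tau; lia.
  clear - fr re defb e1 tau tau1.
  have e2 : (r1 = r2 + n * b)%N by move: fr; rewrite defb !mulnDr !mulnS; lia.
  have dc : (d - c1 = r2)%N by lia.
  constructor 2; exists b.+1 => //; rewrite subn1 /=.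
  have e3 : (r2 = (n ^ 2 - 1) * b)%N.
    by move: re; rewrite dc e2 mulnBl mul1n -mulnn -mulnA mulnDr; lia.
  by split=> //; split; lia.
- have e1 : (c2 + r1 = d)%N by clear - tau o4; lia.
  have {}fr' := fr' nu e1; have {}re' := re' nu.
  have [b defb] : exists b, d = (c1 + b.+1)%N.
    by exists (d - c1).-1; clear - nu; lia.
  clear - fr' re' defb e1 nu nu1.
  have e2 : (c1 = c2 + n * b)%N by move: fr'; rewrite defb !mulnDr !mulnS; lia.
  have dr : (d - r1 = c2)%N by lia.
  constructor 3; exists b.+1 => //; rewrite subn1 /=.
  have e3 : (c2 = (n ^ 2 - 1) * b)%N.
    by move: re'; rewrite dr e2 mulnBl mul1n -mulnn -mulnA mulnDr; lia.
  by split=> //; split; lia.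
- clear sy sy' fr fr' re re'.
  constructor 1; split; try by clear rl rl' ra ra'; lia.
  + have dc : (d - c1 = r2)%N by clear rl rl' ra ra'; lia.
    by move: rl; rewrite dc mulnBr; clear; lia.
  + have dr : (d - r1 = c2)%N by clear rl rl' ra ra'; lia.
    by move: ra'; rewrite dr; clear - o3 nu o4 tau; lia.
Qed.

Theorem layer_trichotomy (k : closedFieldType) n d (a : 'M[k]_n)
    (G : tuples k n d -> Prop) (M : tuples k n d) :
    \det a != 0 -> (1 < n)%N -> generic_class a G -> G M ->
    ~ (d = 1 /\ \rank (rad_mx M) = 0)%N ->
    ~ (d = 2 /\ \rank (rad_mx M) = 1 /\ \rank (rad2_mx M) = 0)%N ->
  let r1 := \rank (rad_mx M) in let r2 := \rank (rad2_mx M) in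
  let c1 := \rank (act_mx M) in let c2 := \rank (act2_mx M) in
  [\/ dual_ranks n d r1 r2 c1 c2, exceptional_ranks n d r1 r2 c1 c2
    | exceptional_ranks n d c1 c2 r1 r2].
Proof.
move=> det_a n1 genG GM not_simple not_uniserial /=.
have sR := soc_sub_rad det_a n1 genG GM not_simple.
apply: layer_trichotomy_arith => //; first exact: (layer_boundsP det_a n1 genG).
have := @layer_boundsP k n d a^T _ n1 _ (generic_class_tr genG) (tr_tuple M).
rewrite rad_tr rad2_tr act_tr act2_tr !mxrank_tr det_tr tr_tupleK.
by apply=> //; rewrite -act_tr -rad_tr; exact: soc_sub_rad_tr.
Qed.

(** * The Zariski topology on tuples *)

Section ZariskiTopology.
Variables (k : closedFieldType) (n d : nat).
Implicit Types (M N : tuples k n d) (Y Z : set (tuples k n d)).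

Definition regular (f : tuples k n d -> k) : Prop :=
  exists p, forall M, f M = poly_eval p M.

Lemma regular_algebra : function_algebra regular.
Proof.
split=> [f g fg [p fp]|c|f g [p fp] [q gq]|f g [p fp] [q gq]].
- by exists p => M; rewrite -fg.
- by exists c%:MP => M; rewrite /poly_eval mevalC.
- by exists (p + q) => M; rewrite fp gq /poly_eval mevalD.
- by exists (p * q) => M; rewrite fp gq /poly_eval mevalM.
Qed.

Lemma regular_coord j : fa_mx regular (fun M => M j).
Proof.
move=> x y; exists 'X_(enum_rank (j, x, y)) => M.
by rewrite /poly_eval mevalXU enum_rankK.
Qed.

Lemma fa_poly_eval (S : Type) (P : (S -> k) -> Prop) p (f : S -> tuples k n d) :
    function_algebra P -> (forall j, fa_mx P (fun s => f s j)) ->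
  P (fun s => poly_eval p (f s)).
Proof.
move=> faP Pf; pose g s := \sum_(m <- msupp p) p@_m * \prod_i
  f s (enum_val i).1.1 (enum_val i).1.2 (enum_val i).2 ^+ m i.
have Pg : P g.
  apply: fa_sum => // m; apply: (fa_mul faP); first exact: (fa_const faP).
  apply: fa_prod => // i; elim: (m i) => [|l IHl]; first exact: (fa_const faP).
  by apply: (fa_ext faP) (fa_mul faP (Pf _ _ _) IHl) => s; rewrite exprS.
by apply: (fa_ext faP) Pg => s; rewrite /g /poly_eval mevalE.
Qed.

Lemma zariski_closed_zeros (I : Type) (f : I -> tuples k n d -> k) :
  (forall i, regular (f i)) -> zariski_closed [set M | forall i, f i M = 0]%classic.
Proof.
move=> reg_f; exists [set p | exists i, forall M, f i M = poly_eval p M]%classic.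
apply/seteqP; split=> M /=; first by move=> fM p [i <-].
by move=> FM i; have [p fp] := reg_f i; rewrite fp; apply: FM; exists i.
Qed.

Lemma zariski_closedI (I : Type) (Z : I -> set (tuples k n d)) :
  (forall i, zariski_closed (Z i)) -> zariski_closed [set M | forall i, Z i M]%classic.
Proof.
move=> clZ; exists [set p | exists i, forall M, Z i M -> poly_eval p M = 0]%classic.
apply/seteqP; split=> M /=; first by move=> ZM p [i]; apply; apply: ZM.
move=> FM i; have [F ZF] := clZ i; rewrite ZF => p Fp; apply: FM.
by exists i => N; rewrite ZF; apply.
Qed.

Lemma zariski_closedU Z1 Z2 : zariski_closed Z1 -> zariski_closed Z2 ->
  zariski_closed (Z1 `|` Z2)%classic.
Proof.
move=> [F1 ->] [F2 ->].
exists [set p | exists p1 p2, [/\ F1 p1, F2 p2 & p = p1 * p2]]%classic.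
apply/seteqP; split=> M /=.
  move=> FM p [p1 [p2 [Fp1 Fp2 ->]]]; rewrite /poly_eval mevalM.
  by case: FM => [/(_ _ Fp1)|/(_ _ Fp2)]; rewrite /poly_eval => ->; rewrite ?mul0r ?mulr0.
move=> FM; have [|/existsNP [p1 /not_implyP [Fp1 p1M]]] :=
  pselect (forall p, F1 p -> poly_eval p M = 0); [by left | right => p2 Fp2].
have /eqP := FM (p1 * p2) (ex_intro _ p1 (ex_intro _ p2 (And3 Fp1 Fp2 erefl))).
by rewrite /poly_eval mevalM mulf_eq0 => /orP [/eqP|/eqP].
Qed.

Lemma zariski_closed0 : zariski_closed (set0 : set (tuples k n d)).
Proof.
have -> : set0 = [set M : tuples k n d | forall i : unit, (1 : k) = 0]%classic.
  by apply/seteqP; split=> M //= /(_ tt) /eqP; rewrite oner_eq0.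
apply: (@zariski_closed_zeros unit (fun _ _ => 1)) => _.
exact: (fa_const regular_algebra).
Qed.

Lemma zariski_closed_seqU (I : eqType) (s : seq I) (Z : I -> set (tuples k n d)) :
    (forall i, zariski_closed (Z i)) ->
  zariski_closed [set M | exists2 i, i \in s & Z i M]%classic.
Proof.
move=> clZ; elim: s => [|i s IHs].
  rewrite (_ : mkset _ = set0); first exact: zariski_closed0.
  by apply/seteqP; split=> M //= [].
rewrite (_ : mkset _ = Z i `|` [set M | exists2 i, i \in s & Z i M])%classic.
  exact: zariski_closedU.
apply/seteqP; split=> M /=.
  by case=> j; rewrite inE => /orP [/eqP -> ZM|sj ZM]; [left | right; exists j].
case=> [ZM|[j sj ZM]]; first by exists i => //; rewrite mem_head.
by exists j => //; rewrite inE sj orbT.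
Qed.

Lemma rank_le_closed p q (A : tuples k n d -> 'M[k]_(p, q)) r :
  fa_mx regular A -> zariski_closed [set M | (\rank (A M) <= r)%N]%classic.
Proof.
move=> regA; rewrite (_ : mkset _ = [set M | forall LR : 'M_(r.+1, p) * 'M_(q, r.+1),
    \det (LR.1 *m A M *m LR.2) = 0]%classic).
  apply: zariski_closed_zeros => -[L R] /=; have faR := regular_algebra.
  by apply: fa_det => //; do 2?[apply: fa_mx_mul => //]; apply: fa_mx_const.
apply/seteqP; split=> M /=.
  move=> rkA [L R] /=; apply/eqP; apply: contraTT rkA => detLR.
  by rewrite -ltnNge; apply/rank_geP; exists L, R.
move=> detLR; rewrite leqNgt; apply/negP => /rank_geP [L [R]].
by rewrite (detLR (L, R)) eqxx.
Qed.

Lemma rank_lt_closed p q (A : tuples k n d -> 'M[k]_(p, q)) r :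
  fa_mx regular A -> zariski_closed [set M | (\rank (A M) < r)%N]%classic.
Proof.
case: r => [|r] regA; last exact: rank_le_closed.
rewrite (_ : mkset _ = set0); first exact: zariski_closed0.
by apply/seteqP; split=> M.
Qed.

Lemma zariski_closed_preimage (f : tuples k n d -> tuples k n d) Z :
    (forall j, fa_mx regular (fun M => f M j)) -> zariski_closed Z ->
  zariski_closed [set M | Z (f M)]%classic.
Proof.
move=> reg_f [F ->].
rewrite (_ : mkset _ = [set M | forall p : {p | F p}, poly_eval (sval p) (f M) = 0]%classic).
  apply: zariski_closed_zeros => p.
  exact: (fa_poly_eval (sval p) regular_algebra reg_f).
apply/seteqP; split=> M /= FM; first by move=> [p Fp]; exact: FM.
by move=> p Fp; exact: (FM (exist _ p Fp)).
Qed.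

Lemma conj_regular g j : fa_mx regular (fun M => conj_tuple g M j).
Proof.
have faR := regular_algebra.
move=> x y; apply: (fa_ext faR) => [M|]; first by rewrite ffunE.
apply: fa_mx_mul => //; last exact: fa_mx_const.
by apply: fa_mx_mul => //; [exact: fa_mx_const | exact: regular_coord].
Qed.

Lemma rep_var_closed (a : 'M[k]_n) : zariski_closed (@rep_var k n a d).
Proof.
pose rel M := \sum_i \sum_j a i j *: (M i *m M j).
rewrite (_ : @rep_var k n a d = [set M : tuples k n d | forall i : ('I_n * 'I_n * 'I_n + unit) * 'I_d * 'I_d,
    (match i.1.1 with inl jl => M jl.1.1 *m M jl.1.2 *m M jl.2
                    | inr _ => rel M end) i.1.2 i.2 = 0]%classic).
  apply: zariski_closed_zeros => -[[[[[i j] l]|[]] x] y] /=; have faR := regular_algebra.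
    by apply: fa_mx_mul => //; [apply: fa_mx_mul => // |]; exact: regular_coord.
  apply: (@fa_mx_sum _ _ _ faR _ _ _ _ _ (fun i M => \sum_j a i j *: (M i *m M j))) => i.
  apply: (@fa_mx_sum _ _ _ faR _ _ _ _ _ (fun j M => a i j *: (M i *m M j))) => j.
  apply: fa_mx_scale => //; first exact: (fa_const faR).
  by apply: fa_mx_mul => //; exact: regular_coord.
apply/seteqP; split=> M /=.
  by case=> M3 Ma [[[[[i j] l]|[]] x] y] /=; rewrite ?M3 ?[rel M]Ma mxE.
move=> M0; split=> [i j l|]; apply/matrixP => x y.
  by rewrite [RHS]mxE; exact: (M0 (inl (i, j, l), x, y)).
by rewrite [RHS]mxE; exact: (M0 (inr tt, x, y)).
Qed.

Definition poly_curve (c : k -> tuples k n d) : Prop :=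
  forall j, fa_mx (@poly_fun k) (fun e => c e j).

Lemma curve_leaves_closed Z (c : k -> tuples k n d) e0 :
    zariski_closed Z -> poly_curve c -> ~ Z (c e0) ->
  exists2 q : {poly k}, q.[e0] != 0 & forall e, q.[e] != 0 -> ~ Z (c e).
Proof.
move=> [F ->] /= pc /existsNP [p /not_implyP [Fp /eqP pc0]].
have [q cq] := fa_poly_eval p (poly_fun_algebra k) pc.
exists q => [|e]; rewrite -cq // => /eqP pe FM; exact: pe (FM p Fp).
Qed.

Lemma line_curve M N : poly_curve (fun e => M + e *: N).
Proof.
move=> j; have faP := poly_fun_algebra k.
by move=> x y; apply: (fa_ext faP) (fa_mx_line (M j) (N j) x y) => e; rewrite !ffunE.
Qed.

(** On a polynomial curve each of two closed sets that miss a point of the curve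
meets it in finitely many points only. *)
Lemma irreducible_by_curves Y : (Y !=set0)%classic ->
    (forall y1 y2, Y y1 -> Y y2 -> exists c, [/\ poly_curve c, c 0 = y1, c 1 = y2
       & forall e, Y (c e)]) ->
  irreducible Y.
Proof.
move=> Y0 joined; split=> // Z1 Z2 cl1 cl2 Y12.
have [|/existsNP [y1 /not_implyP [Yy1 Zy1]]] := pselect (Y `<=` Z1)%classic; first by left.
have [|/existsNP [y2 /not_implyP [Yy2 Zy2]]] := pselect (Y `<=` Z2)%classic; first by right.
have [c [pc c0 c1 Yc]] := joined _ _ Yy1 Yy2.
rewrite -c0 in Zy1; rewrite -c1 in Zy2.
have [q1 q10 Zq1] := curve_leaves_closed cl1 pc Zy1.
have [q2 q20 Zq2] := curve_leaves_closed cl2 pc Zy2.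
have /nonrootP [e] : q1 * q2 != 0 by rewrite mulf_neq0 ?(horner_neq0 q10) ?(horner_neq0 q20).
rewrite hornerM mulf_eq0 negb_or => /andP [/Zq1 Z1e /Zq2 Z2e].
by case: (Y12 _ (Yc e)).
Qed.

Lemma zariski_closure_closed Y : zariski_closed (zariski_closure Y).
Proof.
rewrite /zariski_closure /bigcap.
rewrite (_ : mkset _ = [set M | forall i : {Z | zariski_closed Z /\ (Y `<=` Z)%classic}, sval i M]%classic).
  by apply: zariski_closedI => -[Z []].
apply/seteqP; split=> M /=; first by move=> YM [Z /= ZP]; apply: YM.
by move=> YM Z ZP; have := YM (exist _ Z ZP).
Qed.

Lemma sub_zariski_closure Y : (Y `<=` zariski_closure Y)%classic.
Proof. by move=> M YM Z [_]; apply. Qed.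

Lemma zariski_closure_sub Y Z : zariski_closed Z -> (Y `<=` Z)%classic ->
  (zariski_closure Y `<=` Z)%classic.
Proof. by move=> clZ YZ M; apply; split. Qed.

Lemma irreducible_closure Y : irreducible Y -> irreducible (zariski_closure Y).
Proof.
move=> [[y Yy] irrY]; split; first by exists y; apply: sub_zariski_closure.
move=> Z1 Z2 cl1 cl2 Y12; have YC := @sub_zariski_closure Y.
by have [] := irrY Z1 Z2 cl1 cl2 (subset_trans YC Y12); [left|right]; apply: zariski_closure_sub.
Qed.

Lemma irreducible_sub_seqU (I : eqType) (s : seq I) Y (Z : I -> set (tuples k n d)) :
    irreducible Y -> (forall i, zariski_closed (Z i)) ->
    (Y `<=` [set M | exists2 i, i \in s & Z i M])%classic ->
  exists2 i, i \in s & (Y `<=` Z i)%classic.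
Proof.
move=> [[y Yy] irrY] clZ; elim: s => [|i s IHs] Ys; first by case: (Ys y Yy).
have [|YZ|/IHs [j sj YZ]] := irrY _ _ (clZ i) (zariski_closed_seqU s clZ).
- move=> M /Ys [j]; rewrite inE => /orP [/eqP -> ZM|sj ZM]; [by left | by right; exists j].
- by exists i; rewrite ?mem_head.
- by exists j; rewrite // inE sj orbT.
Qed.

(** Take for Z the union of the closures of those Y i that are not contained in C;
C is not inside this union, for otherwise it would lie in one of the closures
and be equal to it by maximality. *)
Lemma component_open (X C : set (tuples k n d)) (I : finType)
    (Y : I -> set (tuples k n d)) :
    zariski_closed X -> zariski_closed C -> irreducible_component X C ->
    (forall i, irreducible (Y i)) -> (forall i, Y i `<=` X)%classic ->
    (forall M, X M -> exists i, Y i M) ->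
  exists Z, [/\ zariski_closed Z, ~ (C `<=` Z)%classic & forall M, X M -> ~ Z M -> C M].
Proof.
move=> clX clC [CX irrC maxC] irrY YX cover.
pose s := [seq i <- enum I | ~~ `[< (Y i `<=` C)%classic >]].
have clY i : zariski_closed (zariski_closure (Y i)) by exact: zariski_closure_closed.
exists [set M | exists2 i, i \in s & zariski_closure (Y i) M]%classic; split.
- exact: zariski_closed_seqU.
- move=> /(irreducible_sub_seqU irrC clY) [i]; rewrite mem_filter => /andP [/asboolPn YC _] CY.
  apply: YC; rewrite -(maxC _ (irreducible_closure (irrY i)) CY) //.
    exact: sub_zariski_closure.
  exact: zariski_closure_sub.
move=> M /cover [i YM] sM; apply: contrapT => CM; apply: sM.
exists i; last exact: sub_zariski_closure.
by rewrite mem_filter mem_enum andbT; apply/asboolPn => /(_ _ YM).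
Qed.

End ZariskiTopology.

(** * Polynomial charts of the representation variety *)

Section Flags.
Variables (k : fieldType) (d : nat).

Definition top_mx p q : 'M[k]_d := copid_mx (p + q).
Definition middle_mx p q : 'M[k]_(q, d) := \matrix_(i, j) (j == (p + i)%N :> nat)%:R.

Lemma pid_mx_le p q : (p <= q)%N ->
  (pid_mx p : 'M[k]_d) *m (pid_mx q : 'M[k]_d) = pid_mx p.
Proof. by move=> pq; rewrite mul_pid_mx (minn_idPl pq) pid_mx_minv. Qed.

Lemma bottom_top p q : (pid_mx p : 'M[k]_d) *m top_mx p q = 0.
Proof. by rewrite /top_mx /copid_mx mulmxBr mulmx1 pid_mx_le ?leq_addr ?subrr. Qed.

Lemma row_middle p q (i : 'I_q) (l : 'I_d) : l = (p + i)%N :> nat ->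
  row i (middle_mx p q) = delta_mx 0 l.
Proof.
by move=> li; apply/rowP => j; rewrite !mxE /= -val_eqE /= li.
Qed.

Lemma middle_top p q : (p + q <= d)%N -> middle_mx p q *m top_mx p q = 0.
Proof.
move=> pq; apply/row_matrixP => i; rewrite row_mul row0.
have lt_d : (p + i < d)%N by have := ltn_ord i; lia.
rewrite (@row_middle _ _ _ (Ordinal lt_d)) // -rowE; apply/rowP => j.
rewrite !mxE /=; have -> : (p + i < p + q)%N by rewrite ltn_add2l ltn_ord.
by rewrite andbT -val_eqE subrr.
Qed.

Lemma bottom_middle p q : (pid_mx p : 'M[k]_d) *m (middle_mx p q)^T = 0.
Proof.
apply/matrixP => i j; rewrite !mxE big1 // => l _; rewrite !mxE.
case: (i =P l :> nat) => [il|]; last by rewrite mul0r.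
have [ip|] := ltnP i p; last by rewrite mul0r.
suff -> : (l == (p + j)%N :> nat) = false by rewrite mulr0.
by apply/eqP; move: ip; rewrite il; lia.
Qed.

Lemma middle_middle p q : (p + q <= d)%N -> middle_mx p q *m (middle_mx p q)^T = 1%:M.
Proof.
move=> pq; apply/row_matrixP => i; rewrite row_mul row1.
have lt_d : (p + i < d)%N by have := ltn_ord i; lia.
rewrite (@row_middle _ _ _ (Ordinal lt_d)) // -rowE; apply/rowP => j.
by rewrite !mxE /= eqn_add2l eq_sym.
Qed.

Lemma middle_tr_middle p q : (p + q <= d)%N ->
  (middle_mx p q)^T *m middle_mx p q = pid_mx (p + q) - pid_mx p.
Proof.
move=> pq; apply/matrixP => x y; rewrite !mxE.
have [/andP [px xpq]|out] := boolP ((p <= x) && (x < p + q))%N.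
  have xq : (x - p < q)%N by lia.
  rewrite (bigD1 (Ordinal xq)) //= !mxE /= subnKC // eqxx mul1r.
  rewrite big1 ?addr0 => [|l lx].
    by rewrite xpq andbT ltnNge px andbF subr0 eq_sym.
  rewrite !mxE; have -> : (x == (p + l)%N :> nat) = false; last by rewrite mul0r.
  by apply: contraNF lx => /eqP xl; rewrite -val_eqE /= xl addKn.
rewrite big1 => [|l _].
  have [px|px] := ltnP x p; first by rewrite (leq_trans px) ?leq_addr // subrr.
  by move: out; rewrite px /= => /negPf ->; rewrite andbF subrr.
rewrite !mxE; have -> : (x == (p + l)%N :> nat) = false; last by rewrite mul0r.
by apply: contraNF out => /eqP ->; rewrite leq_addr ltn_add2l /=.
Qed.

Lemma row_pid_mul m (g : 'M[k]_d) i :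
  row i ((pid_mx m : 'M_d) *m g) = if (i < m)%N then row i g else 0.
Proof.
rewrite row_mul; case: ifP => im.
  by rewrite [RHS]rowE; congr (_ *m _); apply/rowP => j; rewrite !mxE im andbT eq_sym.
by rewrite -[RHS](mul0mx _ g); congr (_ *m _); apply/rowP => j; rewrite !mxE im andbF.
Qed.

(** The rows of g are bases of W2, of a complement of W2 in W1 and of a complement
of W1, in this order. *)
Lemma flag_basis p q (W2 W1 : 'M[k]_d) : (W2 <= W1)%MS ->
    \rank W2 = p -> \rank W1 = (p + q)%N ->
  exists2 g, g \in unitmx &
    ((pid_mx p : 'M_d) *m g :=: W2)%MS /\ ((pid_mx (p + q) : 'M_d) *m g :=: W1)%MS.
Proof.
move=> W21 rW2 rW1.
pose ext m (B : 'M[k]_(m, d)) (i : nat) : 'rV_d := if insub i is Some i' then row i' B else 0.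
have extE m (B : 'M[k]_(m, d)) (i : 'I_m) : ext m B i = row i B by rewrite /ext valK.
have ext_sub m (B : 'M[k]_(m, d)) i : (ext m B i <= B)%MS.
  by rewrite /ext; case: insubP => [? _ _|_]; rewrite ?row_sub ?sub0mx.
pose V1 := (W1 :\: W2)%MS; pose V0 := (W1^C)%MS.
pose g : 'M[k]_d := \matrix_i (if (i < p)%N then ext _ (row_base W2) i else
  if (i < p + q)%N then ext _ (row_base V1) (i - p)%N else ext _ (row_base V0) (i - (p + q))%N).
have rV1 : \rank V1 = q.
  by have := mxrank_cap_compl W1 W2; rewrite (capmx_idPr W21) rW1 rW2 -/V1; lia.
have rV0 : \rank V0 = (d - (p + q))%N by rewrite mxrank_compl rW1.
have pqd : (p + q <= d)%N by rewrite -rW1 rank_leq_col.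
have sub2 : (W2 <= (pid_mx p : 'M_d) *m g)%MS.
  rewrite -(eq_row_base W2); apply/row_subP => i.
  have ip : (i < p)%N by rewrite -[X in (_ < X)%N]rW2.
  have id : (i < d)%N by lia.
  have := row_sub (Ordinal id) ((pid_mx p : 'M_d) *m g).
  by rewrite row_pid_mul /= ip rowK /= ip extE.
have sub1 : (V1 <= (pid_mx (p + q) : 'M_d) *m g)%MS.
  rewrite -(eq_row_base V1); apply/row_subP => i.
  have iq : (i < q)%N by rewrite -[X in (_ < X)%N]rV1.
  have id : (p + i < d)%N by lia.
  have := row_sub (Ordinal id) ((pid_mx (p + q) : 'M_d) *m g).
  rewrite row_pid_mul /= ltn_add2l iq rowK /= ltn_add2l iq.
  by rewrite ltnNge leq_addr /= addKn extE.
have sub0 : (V0 <= g)%MS.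
  rewrite -(eq_row_base V0); apply/row_subP => i.
  have iq : (i < d - (p + q))%N by rewrite -[X in (_ < X)%N]rV0.
  have id : (p + q + i < d)%N by lia.
  have := row_sub (Ordinal id) g; rewrite rowK /=.
  rewrite !ltnNge leq_addr /=; have -> : (p <= p + q + i)%N by lia.
  by rewrite /= addKn extE.
have pidW2 : ((pid_mx p : 'M_d) *m g <= W2)%MS.
  apply/row_subP => i; rewrite row_pid_mul; case: ifP => ip; last exact: sub0mx.
  by rewrite rowK ip; apply: submx_trans (ext_sub _ _ _) _; rewrite eq_row_base.
have sub21 : ((pid_mx p : 'M_d) *m g <= (pid_mx (p + q) : 'M_d) *m g)%MS.
  by rewrite -(pid_mx_le (leq_addr q p)) -mulmxA submxMl.
have W1sum : (W1 <= W2 + V1)%MS.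
  by rewrite -(addsmx_diff_cap_eq W1 W2) addsmxC addsmxS ?capmxSr.
have pidW1 : ((pid_mx (p + q) : 'M_d) *m g <= W1)%MS.
  apply/row_subP => i; rewrite row_pid_mul; case: ifP => ipq; last exact: sub0mx.
  rewrite rowK ipq; case: ifP => ip.
    by apply: submx_trans (ext_sub _ _ _) _; rewrite eq_row_base.
  by apply: submx_trans (ext_sub _ _ _) _; rewrite eq_row_base diffmxSl.
have subW1 : (W1 <= (pid_mx (p + q) : 'M_d) *m g)%MS.
  apply: submx_trans W1sum _; rewrite addsmx_sub sub1 andbT.
  exact: submx_trans sub21.
exists g.
  rewrite -row_full_unit -sub1mx; apply: submx_trans (_ : (W1 + V0 <= g)%MS).
    by rewrite sub1mx addsmx_compl_full.
  by rewrite addsmx_sub sub0 andbT (submx_trans subW1) ?submxMl.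
by split; apply/eqmxP; rewrite ?pidW2 ?sub2 ?pidW1 ?subW1.
Qed.

End Flags.

Section Charts.
Variables (k : closedFieldType) (n d : nat) (a : 'M[k]_n).
Hypothesis det_a : \det a != 0.

(** Call the coordinates below p bottom, those from p to p + q middle and the
remaining ones top: acting on rows, the tuple maps top to middle by A, middle to
bottom by B and top to bottom by C. *)
Definition block_tuple p q (A : 'I_n -> 'M[k]_(d, q)) (B : 'I_n -> 'M[k]_(q, d))
    (C : 'I_n -> 'M[k]_d) : tuples k n d :=
  [ffun j => top_mx k d p q *m A j *m middle_mx k d p q +
     (middle_mx k d p q)^T *m B j *m pid_mx p + top_mx k d p q *m C j *m pid_mx p].

Lemma block_tuple_mul p q (A : 'I_n -> 'M_(d, q)) (B : 'I_n -> 'M_(q, d)) (C : 'I_n -> 'M_d) i j : (p + q <= d)%N ->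
  block_tuple p A B C i *m block_tuple p A B C j =
  top_mx k d p q *m (A i *m B j) *m pid_mx p.
Proof.
move=> pq; rewrite !ffunE; set e0 := top_mx _ _ _ _; set c := middle_mx _ _ _ _.
set e2 : 'M_d := pid_mx p.
have ce0 x (X : 'M_(d, x)) : c *m (e0 *m X) = 0.
  by rewrite mulmxA middle_top // mul0mx.
have e2e0 x (X : 'M_(d, x)) : e2 *m (e0 *m X) = 0.
  by rewrite mulmxA bottom_top // mul0mx.
have e2c x (X : 'M_(q, x)) : e2 *m (c^T *m X) = 0.
  by rewrite mulmxA bottom_middle // mul0mx.
have cc x (X : 'M_(q, x)) : c *m (c^T *m X) = X.
  by rewrite mulmxA middle_middle // mul1mx.
clearbody e0 c e2.
rewrite !mulmxDl !mulmxDr -!mulmxA !(ce0, e2e0, e2c, cc) !mulmx0 !addr0 !add0r.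
by [].
Qed.

Lemma block_tuple_rep p q (A : 'I_n -> 'M_(d, q)) (B : 'I_n -> 'M_(q, d)) (C : 'I_n -> 'M_d) : (p + q <= d)%N ->
  \sum_i \sum_j a i j *: (A i *m B j) = 0 -> rep_var a (block_tuple (q := q) p A B C).
Proof.
move=> pq AB; split=> [i j l|].
  suff N0 : (pid_mx p : 'M_d) *m block_tuple p A B C l = 0.
    by rewrite block_tuple_mul // -[LHS]mulmxA N0 mulmx0.
  rewrite ffunE mulmxDr mulmxDr !mulmxA.
  by rewrite bottom_top bottom_middle !mul0mx !addr0.
transitivity (top_mx k d p q *m (\sum_i \sum_j a i j *: (A i *m B j)) *m (pid_mx p : 'M_d)).
  rewrite mulmx_sumr mulmx_suml; apply: eq_bigr => i _.
  rewrite mulmx_sumr mulmx_suml; apply: eq_bigr => j _.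
  by rewrite block_tuple_mul // -scalemxAr -scalemxAl.
by rewrite AB mulmx0 mul0mx.
Qed.

(** Conjugation by h up to the factor det h, and polynomial in h. *)
Definition adj_conj (h : 'M[k]_d) (N : tuples k n d) : tuples k n d :=
  [ffun j => h *m N j *m \adj h].

Lemma adj_conj_mul h N i j :
  adj_conj h N i *m adj_conj h N j = \det h *: (h *m (N i *m N j) *m \adj h).
Proof.
rewrite !ffunE -!mulmxA (mulmxA (\adj h)) mul_adj_mx mul_scalar_mx.
by rewrite -!scalemxAr.
Qed.

Lemma adj_conj_rep h N : rep_var a N -> rep_var a (adj_conj h N).
Proof.
move=> [N3 Na]; split=> [i j l|].
  rewrite adj_conj_mul ffunE -scalemxAl -!mulmxA (mulmxA (\adj h)) mul_adj_mx.
  rewrite mul_scalar_mx -!scalemxAr (mulmxA (N j)) (mulmxA (N i)) (mulmxA (N i)).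
  by rewrite N3 mul0mx mulmx0 !scaler0.
transitivity (\det h *: (h *m (\sum_i \sum_j a i j *: (N i *m N j)) *m \adj h)).
  rewrite mulmx_sumr mulmx_suml scaler_sumr; apply: eq_bigr => i _.
  rewrite mulmx_sumr mulmx_suml scaler_sumr; apply: eq_bigr => j _.
  by rewrite adj_conj_mul -scalemxAr -scalemxAl !scalerA mulrC.
by rewrite Na mulmx0 mul0mx scaler0.
Qed.

Section Chart.
Variables (p q r : nat).
Let nq := (\sum_(j < n) q)%N.

(** Here copid_r adj(L) L pid_r = det L copid_r pid_r = 0 for all L, so the twisted
blocks of [chart_A] are orthogonal to those of [chart_B] on the whole parameter
space, without any condition of invertibility. *)
Definition chart_A (L : 'M[k]_nq) (Y : 'M[k]_(d, nq)) (i : 'I_n) : 'M[k]_(d, q) :=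
  \sum_l invmx a l i *: submxrow (Y *m copid_mx r *m \adj L) l.

Definition chart_B (L : 'M[k]_nq) (H : 'M[k]_d) (j : 'I_n) : 'M[k]_(q, d) :=
  submxcol (L *m (pid_mx r : 'M_(nq, d)) *m H) j.

Definition chart h L H Y C :=
  adj_conj h (block_tuple p (chart_A L Y) (chart_B L H) C).

Lemma untwist_sum m (A : 'I_n -> 'M[k]_(d, q)) (B : 'I_n -> 'M[k]_(q, m)) :
  \sum_i \sum_j a i j *: ((\sum_l invmx a l i *: A l) *m B j) = \sum_j A j *m B j.
Proof.
rewrite exchange_big; apply: eq_bigr => j _ /=.
under eq_bigr do rewrite mulmx_suml scaler_sumr.
rewrite exchange_big (bigD1 j) //= [X in _ + X]big1 => [|l lj].
  rewrite addr0 -[RHS]scale1r.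
  have /matrixP/(_ j j) : invmx a *m a = 1%:M by rewrite mulVmx // unitmxE unitfE.
  rewrite !mxE eqxx mulr1n => <-; rewrite scaler_suml.
  by apply: eq_bigr => i _; rewrite -scalemxAl scalerA mulrC.
have /matrixP/(_ l j) : invmx a *m a = 1%:M by rewrite mulVmx // unitmxE unitfE.
rewrite !mxE (negPf lj) mulr0n => e; rewrite -[RHS](scale0r (A l *m B j)) -e scaler_suml.
by apply: eq_bigr => i _; rewrite -scalemxAl scalerA mulrC.
Qed.

Lemma chart_rep h L H Y C : (p + q <= d)%N -> rep_var a (chart h L H Y C).
Proof.
move=> pq; apply: adj_conj_rep; apply: block_tuple_rep => //.
rewrite untwist_sum -mul_mxrow_mxcol submxrowK submxcolK.
rewrite -!mulmxA (mulmxA (\adj L)) mul_adj_mx mul_scalar_mx -!scalemxAr.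
rewrite (mulmxA (copid_mx r)) mulmxBl mul1mx mul_pid_mx minnn pid_mx_minv subrr.
by rewrite mul0mx mulmx0 scaler0.
Qed.

Definition chart_image : set (tuples k n d) :=
  [set M | exists h L H Y C, M = chart h L H Y C]%classic.

(** The image of a segment of the affine parameter space is a polynomial curve. *)
Lemma chart_irreducible : irreducible chart_image.
Proof.
apply: irreducible_by_curves; first by exists (chart 0 0 0 0 (fun=> 0)); do 5!eexists.
move=> _ _ [h1 [L1 [H1 [Y1 [C1 ->]]]]] [h2 [L2 [H2 [Y2 [C2 ->]]]]].
pose ln m s (A B : 'M[k]_(m, s)) e := A + e *: (B - A).
have ln0 m s A B : ln m s A B 0 = A by rewrite /ln scale0r addr0.
have ln1 m s A B : ln m s A B 1 = B by rewrite /ln scale1r addrC subrK.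
exists (fun e => chart (ln _ _ h1 h2 e) (ln _ _ L1 L2 e) (ln _ _ H1 H2 e)
  (ln _ _ Y1 Y2 e) (fun j => ln _ _ (C1 j) (C2 j) e)); split.
- have faP := poly_fun_algebra k.
  have fln m s A B : fa_mx (@poly_fun k) (ln m s A B) by exact: fa_mx_line.
  have fc m s (A : 'M[k]_(m, s)) : fa_mx (@poly_fun k) (fun=> A) by exact: fa_mx_const.
  have fm := fa_mx_mul faP; have fadd := fa_mx_add faP.
  move=> j x y; apply: (fa_ext faP) => [e|]; first by rewrite !ffunE.
  apply: (fm); last by apply: fa_mx_adj => //; exact: fln.
  apply: (fm); [exact: fln | apply: (fadd); first apply: (fadd)].
  + apply: (fm); [apply: (fm); [exact: fc|] | exact: fc].
    apply: fa_mx_sum => // l; apply: fa_mx_scale => //; first exact: (fa_const faP).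
    apply: fa_mx_subrow => //; apply: (fm); last by apply: fa_mx_adj => //; exact: fln.
    by apply: (fm); [exact: fln | exact: fc].
  + apply: (fm); [apply: (fm); [exact: fc|] | exact: fc].
    apply: fa_mx_subcol => //; apply: (fm); last exact: fln.
    by apply: (fm); [exact: fln | exact: fc].
  + by apply: (fm); [apply: (fm); [exact: fc | exact: fln] | exact: fc].
- by rewrite !ln0; congr chart; apply/funext => j; rewrite ln0.
- by rewrite !ln1; congr chart; apply/funext => j; rewrite ln1.
by move=> e; do 5!eexists.
Qed.

End Chart.

Lemma scale_rep c (M : tuples k n d) : rep_var a M -> rep_var a (c *: M).
Proof.
move=> [M3 Ma]; split=> [i j l|].
  by rewrite !ffunE !(=^~ scalemxAl, =^~ scalemxAr) M3 !scaler0.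
transitivity ((c * c) *: \sum_i \sum_j a i j *: (M i *m M j)).
  rewrite scaler_sumr; apply: eq_bigr => i _; rewrite scaler_sumr.
  apply: eq_bigr => j _; rewrite !ffunE -scalemxAr -scalemxAl !scalerA.
  by congr (_ *: _); ring.
by rewrite Ma scaler0.
Qed.

Lemma conj_rep g (M : tuples k n d) : g \in unitmx -> rep_var a M -> rep_var a (conj_tuple g M).
Proof.
move=> ug [M3 Ma].
have mulE i j : conj_tuple g M i *m conj_tuple g M j = g *m (M i *m M j) *m invmx g.
  by rewrite !ffunE !mulmxA mulmxKV.
split=> [i j l|].
  by rewrite mulE ffunE !mulmxA mulmxKV // -(mulmxA g) -(mulmxA g) M3 mulmx0 mul0mx.
transitivity (g *m (\sum_i \sum_j a i j *: (M i *m M j)) *m invmx g).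
  rewrite mulmx_sumr mulmx_suml; apply: eq_bigr => i _.
  rewrite mulmx_sumr mulmx_suml; apply: eq_bigr => j _.
  by rewrite mulE -scalemxAr -scalemxAl.
by rewrite Ma mulmx0 mul0mx.
Qed.

(** Conjugate M by a basis adapted to Rad2 <= Rad, and factor the column of the
blocks B through its rank; the factor det of [adj_conj] is absorbed by scaling. *)
Lemma chart_cover M : rep_var a M ->
  exists p q r : nat, [/\ (p + q <= d)%N, (r <= n * d)%N & chart_image p q r M].
Proof.
move=> XM; pose W2 := <<rad2_mx M>>%MS; pose W1 := <<rad_mx M>>%MS.
have W21 : (W2 <= W1)%MS by rewrite !genmxE rad2_sub_rad.
pose p := \rank W2; pose q := (\rank W1 - \rank W2)%N.
have rW1 : \rank W1 = (p + q)%N by rewrite subnKC // mxrankS.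
have pq : (p + q <= d)%N by rewrite -rW1 rank_leq_col.
have [g ug [gW2 gW1]] := flag_basis W21 (erefl : \rank W2 = p) rW1.
pose c := (\det (invmx g))^-1.
pose N : tuples k n d := c *: conj_tuple g M.
have detg : \det (invmx g) != 0 by rewrite -unitfE -unitmxE unitmx_inv.
have MN : M = adj_conj (invmx g) N.
  apply/ffunP => j; rewrite !ffunE -scalemxAr -scalemxAl !mulmxA mulVmx // mul1mx.
  rewrite -mulmxA mul_mx_adj.
  by rewrite mul_mx_scalar scalerA mulVf // scale1r.
have XN : rep_var a N by apply: scale_rep; apply: conj_rep.
pose e2 : 'M[k]_d := pid_mx p; pose e1 : 'M[k]_d := pid_mx (p + q).
pose e0 := top_mx k d p q; pose m := middle_mx k d p q.
have e2N j : e2 *m N j = 0.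
  have : (e2 *m g <= kermx (act_mx M))%MS by rewrite gW2 genmxE (rad2_sub_soc XM).
  move=> /sub_kermxP; rewrite mul_act_mx -(@mxrow0 k n (fun=> d)) => /eq_mxrowP eg.
  by rewrite !ffunE -scalemxAr !mulmxA eg mul0mx scaler0.
have sub_pid s (A : 'M[k]_d) : (A <= (pid_mx s : 'M[k]_d))%MS -> A *m pid_mx s = A.
  by move=> /submxP [x ->]; rewrite -mulmxA pid_mx_le.
have Ne1 j : N j *m e1 = N j.
  apply: sub_pid; rewrite !ffunE scalemx_sub //.
  rewrite -[pid_mx _](mulmxK ug) submxMr // gW1 genmxE mul_sub_rad //.
have e1Ne2 j : e1 *m N j *m e2 = e1 *m N j.
  apply: sub_pid; rewrite !ffunE -scalemxAr scalemx_sub // !mulmxA.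
  rewrite -[pid_mx p](mulmxK ug) submxMr // gW2 genmxE.
  by apply: mul_sub_rad2; rewrite gW1 genmxE.
have mm : m^T *m m = e1 - e2 by exact: middle_tr_middle.
(* N maps top to middle and bottom, and middle to bottom. *)
have e00 : e0 *m e0 = e0 by rewrite /e0 /top_mx copid_mx_id.
have e22 : e2 *m e2 = e2 by exact: pid_mx_le.
have defN : N = block_tuple p (fun j => e0 *m N j *m m^T) (fun j => m *m N j *m e2) N.
  apply/ffunP => j; rewrite [RHS]ffunE -/e0 -/m.
  have -> : e0 *m (e0 *m N j *m m^T) *m m = e0 *m N j *m (e1 - e2).
    by rewrite -mm !mulmxA e00.
  have -> : m^T *m (m *m N j *m e2) *m pid_mx p = (e1 - e2) *m N j *m e2.
    by rewrite -mm -!mulmxA e22.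
  have e0E : e0 = 1%:M - e1 by [].
  rewrite -/e2; clearbody e0; rewrite mulmxBr addrAC addrNK -(mulmxA e0) Ne1.
  rewrite mulmxBl e2N subr0 e1Ne2 e0E mulmxBl mul1mx addrNK //.
pose A i := e0 *m N i *m m^T; pose B j := m *m N j *m e2.
pose A' j := \sum_i a i j *: A i.
have AB : \sum_j A' j *m B j = 0.
  transitivity (\sum_i \sum_j a i j *: (N i *m N j)); last by case: XN.
  rewrite [RHS]exchange_big; apply: eq_bigr => j _ /=.
  rewrite mulmx_suml; apply: eq_bigr => i _; rewrite -scalemxAl; congr (_ *: _).
  rewrite [in RHS]defN block_tuple_mul // -/e0 -/m -/e2.
  by rewrite !mulmxA e00 -!mulmxA e22.
pose P := \mxcol_j B j; pose r := \rank P.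
pose L := col_ebase P; pose Y0 := (\mxrow_j A' j) *m L.
have Y0pid : Y0 *m (pid_mx r : 'M_(_, d)) = 0.
  have : (\mxrow_j A' j) *m P = 0 by rewrite mul_mxrow_mxcol.
  rewrite -(mulmx_ebase P) !mulmxA => /(congr1 (fun X => X *m invmx (row_ebase P))).
  by rewrite mulmxK ?row_ebase_unit // mul0mx.
have Y0co : Y0 *m copid_mx r = Y0.
  rewrite mulmxBr mulmx1 -(pid_mx_id _ _ _ (rank_leq_col P)) mulmxA.
  by rewrite Y0pid mul0mx subr0.
have uL : \det L != 0 by rewrite -unitfE -unitmxE col_ebase_unit.
exists p, q, r; split=> //.
  by apply: leq_trans (rank_leq_row _) _; rewrite sum_nat_const card_ord leq_mul2l; lia.
exists (invmx g), L, (row_ebase P), ((\det L)^-1 *: Y0), N.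
rewrite MN; congr adj_conj; rewrite {1}defN; congr block_tuple.
  apply/funext => i; rewrite /chart_A.
  have -> : (\det L)^-1 *: Y0 *m copid_mx r *m \adj L = \mxrow_j A' j.
    rewrite -scalemxAl Y0co -scalemxAl -mulmxA mul_mx_adj mul_mx_scalar.
    by rewrite scalerA mulVf ?scale1r.
  under eq_bigr do rewrite mxrowK scaler_sumr.
  rewrite exchange_big (bigD1 i) //= [X in _ + X]big1 => [|l li].
    have /matrixP/(_ i i) : a *m invmx a = 1%:M by rewrite mulmxV // unitmxE unitfE.
    rewrite !mxE eqxx mulr1n => e; rewrite addr0 -[LHS]scale1r -e scaler_suml.
    by apply: eq_bigr => j _; rewrite scalerA mulrC.
  have /matrixP/(_ l i) : a *m invmx a = 1%:M by rewrite mulmxV // unitmxE unitfE.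
  rewrite !mxE (negPf li) mulr0n => e; rewrite -[RHS](scale0r (A l)) -e scaler_suml.
  by apply: eq_bigr => j _; rewrite scalerA mulrC.
by apply/funext => j; rewrite /chart_B mulmx_ebase mxcolK.
Qed.

End Charts.

(** * Layers as subspaces, and the strata of fixed radical layering *)

Section VectorSpaces.
Variables (k : closedFieldType) (n d : nat).
Implicit Types (M : tuples k n d) (v : 'cV[k]_d).

(** Translates between subspaces of column vectors and row spaces. *)
Lemma dim_of_rows (U : {vspace 'cV[k]_d}) m (B : 'M_(m, d)) :
  (forall v, (v \in U) = (v^T <= B)%MS) -> \dim U = \rank B.
Proof.
move=> memU.
pose g := linfun (trmx \o mulmxr (row_base B) : {linear 'rV[k]_(\rank B) -> 'cV[k]_d}).
have gE u : g u = (u *m row_base B)^T by rewrite lfunE.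
have -> : U = limg g.
  apply/vspaceP => v; rewrite memU; apply/idP/memv_imgP => [|[u _ ->]].
    rewrite -(eq_row_base B) => /submxP [u vu]; exists u; first exact: memvf.
    by rewrite gE -vu trmxK.
  by rewrite gE trmxK -(eq_row_base B) submxMl.
rewrite limg_dim_eq.
  by rewrite dimvf /dim /= mul1n.
apply/eqP; rewrite -subv0; apply/subvP => u; rewrite memv_cap memvf /= memv_ker gE.
rewrite trmx_eq0 mulmx_free_eq0 ?row_base_free // => /eqP ->; exact: mem0v.
Qed.

Definition word_mx M (w : seq 'I_n) : 'M[k]_d := \prod_(j <- w) M j.

Lemma mem_mod_rad M i v :
  (v \in mod_rad M i) = (v^T <= \sum_(w : i.-tuple 'I_n) (word_mx M w)^T)%MS.
Proof.
apply/memv_sumP/sub_sumsmxP => [[vs vsP ->]|[u vu]].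
  have vsw (w : i.-tuple 'I_n) : exists x, vs w == word_mx M w *m x.
    have /memv_imgP [x _ ->] := vsP w isT; exists x.
    by rewrite lfunE.
  exists (fun w => (xchoose (vsw w))^T); rewrite linear_sum; apply: eq_bigr => w _.
  by rewrite -trmx_mul -(eqP (xchooseP (vsw w))).
exists (fun w : i.-tuple 'I_n => word_mx M w *m (u w)^T) => [w _|].
  by apply/memv_imgP; exists (u w)^T; rewrite ?memvf // lfunE.
rewrite -[v]trmxK vu linear_sum; apply: eq_bigr => w _.
by rewrite /= trmx_mul trmxK.
Qed.

Lemma mem_mod_soc M i v :
  reflect (forall w : i.-tuple 'I_n, word_mx M w *m v = 0) (v \in mod_soc M i).
Proof.
apply: (iffP idP) => [vs w|vw].
  have : v \in lker (word_act M w).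
    by apply: (subvP _ _ vs); apply: (@bigcapv_inf _ _ _ w).
  by rewrite memv_ker lfunE => /eqP.
rewrite memvE; apply/subv_bigcapP => w _; rewrite -memvE memv_ker lfunE.
by apply/eqP; exact: vw.
Qed.

Lemma mem_std_flag m v : (v \in std_flag k d m) = (v^T <= (pid_mx m : 'M_d))%MS.
Proof.
apply/idP/idP.
  pose W : {vspace 'cV[k]_d} := lker (linfun (mulmx (copid_mx m : 'M[k]_d))).
  have sW : (std_flag k d m <= W)%VS.
    apply/span_subvP => z /mapP [j]; rewrite mem_filter => /andP [jm _] ->.
    rewrite memv_ker lfunE /= -colE; apply/eqP/matrixP => x y; rewrite !mxE.
    by rewrite -val_eqE; case: (x =P j :> nat) => [->|]; rewrite ?jm subrr.
  move/(subvP sW); rewrite memv_ker lfunE /= mulmxBl mul1mx subr_eq0 => /eqP ->.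
  by rewrite trmx_mul tr_pid_mx submxMl.
move=> /submxP [x vx].
have v0 (j : 'I_d) : ~~ (j < m)%N -> v j 0 = 0.
  move=> jm; rewrite -[v]trmxK vx !mxE big1 // => l _; rewrite !mxE.
  case: (l =P j :> nat) => [->|]; last by rewrite mulr0.
  by rewrite (negPf jm) mulr0.
rewrite [v]matrix_sum_delta; apply: memv_suml => j _; apply: memv_suml => l _.
rewrite ord1; case jm : (j < m)%N; last by rewrite v0 ?jm // scale0r mem0v.
apply/memvZ/memv_span/mapP; exists j => //.
by rewrite mem_filter jm mem_enum.
Qed.

Lemma word1 M (w : 1.-tuple 'I_n) : word_mx M w = M (thead w).
Proof. by case/tupleP: w => j w; rewrite tuple0 /word_mx /= big_seq1 theadE. Qed.

Lemma word_mx_cons M j w : word_mx M (j :: w) = M j *m word_mx M w.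
Proof. by rewrite /word_mx big_cons. Qed.

Lemma mod_rad1E M :
  (\sum_(w : 1.-tuple 'I_n) (word_mx M w)^T :=: rad_mx (tr_tuple M))%MS.
Proof.
apply/eqmxP/andP; split.
  apply/sumsmx_subP => w _; rewrite word1.
  have := sub_mxcol (tr_tuple M) (thead w); rewrite ffunE; exact.
apply/mxcol_sub => j; apply: (sumsmx_sup [tuple j]) => //.
by rewrite word1 ffunE theadE.
Qed.

Lemma mod_rad2E M :
  (\sum_(w : 2.-tuple 'I_n) (word_mx M w)^T :=: rad2_mx (tr_tuple M))%MS.
Proof.
rewrite rad2_mxE; apply/eqmxP/andP; split.
  apply/sumsmx_subP => w _; case/tupleP: w => i w; rewrite word_mx_cons word1 trmx_mul.
  apply: submx_trans (sub_mxcol (fun j => \mxcol_i (tr_tuple M i *m tr_tuple M j)) i).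
  have := sub_mxcol (fun j => tr_tuple M j *m tr_tuple M i) (thead w).
  by rewrite !ffunE.
apply/mxcol_sub => j; apply/mxcol_sub => i.
apply: (sumsmx_sup [tuple j; i]) => //.
by rewrite /word_mx !big_cons big_nil mulr1 !ffunE -trmx_mul.
Qed.

Variable a : 'M[k]_n.

Lemma word_mx_eq0 M (w : seq 'I_n) : rep_var a M -> (2 < size w)%N -> word_mx M w = 0.
Proof.
case=> M3 _; case: w => [|i [|j [|l w]]] //= _.
by rewrite !word_mx_cons !mulmxA M3 mul0mx.
Qed.

Lemma dim_mod_soc0 M : \dim (mod_soc M 0) = 0%N.
Proof.
apply: etrans (@mxrank0 k 1 d); apply: dim_of_rows => v.
have -> : (v^T <= (0 : 'M[k]_(1, d)))%MS = (v == 0).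
  apply/idP/eqP => [/submxP [x]|->]; last by rewrite trmx0 sub0mx.
  by rewrite mulmx0 => /(congr1 trmx); rewrite trmxK trmx0.
apply/mem_mod_soc/eqP => [/(_ [tuple])|-> w]; last by rewrite mulmx0.
by rewrite /word_mx big_nil mul1mx.
Qed.

Lemma dim_mod_soc1 M : \dim (mod_soc M 1) = (d - \rank (rad_mx M))%N.
Proof.
rewrite -mxrank_tr -act_tr -mxrank_ker; apply: dim_of_rows => v.
apply/mem_mod_soc/idP => [vw|/socP vM w].
  apply/socP => j; rewrite ffunE -trmx_mul.
  by have := vw [tuple j]; rewrite word1 theadE => ->; rewrite trmx0.
rewrite word1; apply: trmx_inj; rewrite trmx_mul trmx0.
by have := vM (thead w); rewrite ffunE.
Qed.

Lemma dim_mod_soc2 M : \dim (mod_soc M 2) = (d - \rank (rad2_mx M))%N.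
Proof.
rewrite -mxrank_tr -act2_tr -mxrank_ker; apply: dim_of_rows => v.
apply/mem_mod_soc/idP => [vw|/soc2P vM w].
  apply/soc2P => j i; rewrite !ffunE -!trmx_mul.
  have := vw [tuple i; j]; rewrite /word_mx !big_cons big_nil mulr1 -mulmxA => ->.
  by rewrite trmx0.
case/tupleP: w => i w; rewrite word_mx_cons word1 -mulmxA; apply: trmx_inj.
by have := vM (thead w) i; rewrite !ffunE -!trmx_mul trmx0.
Qed.

Lemma dim_mod_soc3 M : rep_var a M -> \dim (mod_soc M 3) = d.
Proof.
move=> XM; apply: etrans (@mxrank1 k d); apply: dim_of_rows => v; rewrite submx1.
by apply/mem_mod_soc => w; rewrite (word_mx_eq0 XM) ?size_tuple // mul0mx.
Qed.

Lemma sdimE M : rep_var a M ->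
  sdim M = vec3 (d - \rank (rad_mx M)) (\rank (rad_mx M) - \rank (rad2_mx M))
                (\rank (rad2_mx M)).
Proof.
move=> XM; have r1d := rank_leq_col (rad_mx M); have r2d := rank_leq_col (rad2_mx M).
have r21 := mxrankS (rad2_sub_rad M).
have := dim_mod_soc3 XM; have := dim_mod_soc2 M; have := dim_mod_soc1 M.
have := dim_mod_soc0 M => s0 s1 s2 s3.
have e0 : enum 'I_0 = [::] by apply: size0nil; rewrite size_enum_ord.
apply: val_inj; rewrite /= !enum_ordSl e0 /= /bump /= s0 s1 s2 s3 subn0.
move: r1d r2d r21; move: (\rank (rad_mx M)) (\rank (rad2_mx M)) => x y; clear.
by move=> xd yd yx; congr [:: _; _; _]; lia.
Qed.

End VectorSpaces.

Section Conjugation.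
Variables (k : closedFieldType) (n d : nat) (a : 'M[k]_n).
Implicit Types (M N : tuples k n d) (g : 'M[k]_d).

Lemma conj_tupleK g M : g \in unitmx -> conj_tuple (invmx g) (conj_tuple g M) = M.
Proof.
move=> ug; apply/ffunP => j; rewrite !ffunE invmxK !mulmxA mulVmx // mul1mx.
by rewrite mulmxKV.
Qed.

Lemma tr_conj_tuple g M : g \in unitmx ->
  tr_tuple (conj_tuple g M) = conj_tuple (invmx g)^T (tr_tuple M).
Proof.
move=> ug; apply/ffunP => j; rewrite !ffunE !trmx_mul !trmx_inv invmxK mulmxA.
by [].
Qed.

Lemma rad_conj g M : g \in unitmx ->
  (rad_mx (conj_tuple g M) :=: rad_mx M *m invmx g)%MS.
Proof.
move=> ug; apply/eqmxP/andP; split.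
  apply/mxcol_sub => j; rewrite ffunE; apply: submxMr.
  by apply: mulmx_sub; exact: sub_mxcol.
rewrite mxcol_mul; apply/mxcol_sub => j.
rewrite -[M j](mulKmx ug) -mulmxA mulmx_sub //.
by have := sub_mxcol (conj_tuple g M) j; rewrite ffunE.
Qed.

Lemma rad2_conj g M : g \in unitmx ->
  (rad2_mx (conj_tuple g M) :=: rad2_mx M *m invmx g)%MS.
Proof.
move=> ug; apply/eqmxP/andP; split.
  apply/row_subP => i; have /rad2P [u uR ->] := row_sub i (rad2_mx (conj_tuple g M)).
  apply: summx_sub => j _; rewrite ffunE !mulmxA; apply: submxMr.
  apply: mul_sub_rad2; rewrite -[rad_mx M](mulmxKV ug) submxMr //.
  by rewrite -(rad_conj M ug).
rewrite mxcol_mul; apply/mxcol_sub => j.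
have -> : rad_mx M *m M j *m invmx g =
    rad_mx M *m invmx g *m conj_tuple g M j.
  by rewrite ffunE !mulmxA mulmxKV.
by apply: mul_sub_rad2; rewrite (rad_conj M ug).
Qed.

Lemma rank_act_conj_le g M : (\rank (act_mx (conj_tuple g M)) <= \rank (act_mx M))%N.
Proof.
have -> : act_mx (conj_tuple g M) = g *m (act_mx M *m power_mx n (invmx g)).
  rewrite /act_mx mul_mxrow_mxdiag mul_mxrow; apply: eq_mxrow => j.
  by rewrite ffunE mulmxA.
by apply: leq_trans (mxrankM_maxr _ _) _; exact: mxrankM_maxl.
Qed.

Lemma rank_act2_conj_le g M : g \in unitmx ->
  (\rank (act2_mx (conj_tuple g M)) <= \rank (act2_mx M))%N.
Proof.
move=> ug; have -> : act2_mx (conj_tuple g M) =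
    g *m (act2_mx M *m \mxdiag_(i < n) power_mx n (invmx g)).
  rewrite !act2_mxE mul_mxrow_mxdiag mul_mxrow; apply: eq_mxrow => i.
  rewrite mul_mxrow_mxdiag mul_mxrow; apply: eq_mxrow => j.
  by rewrite !ffunE !mulmxA mulmxKV.
by apply: leq_trans (mxrankM_maxr _ _) _; exact: mxrankM_maxl.
Qed.

Lemma rank_act_conj g M : g \in unitmx ->
  \rank (act_mx (conj_tuple g M)) = \rank (act_mx M).
Proof.
move=> ug; apply/eqP; rewrite eqn_leq rank_act_conj_le /=.
by rewrite -{1}(conj_tupleK M ug) rank_act_conj_le.
Qed.

Lemma rank_act2_conj g M : g \in unitmx ->
  \rank (act2_mx (conj_tuple g M)) = \rank (act2_mx M).
Proof.
move=> ug; apply/eqP; rewrite eqn_leq rank_act2_conj_le //=.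
by rewrite -{1}(conj_tupleK M ug) rank_act2_conj_le ?unitmx_inv.
Qed.

Lemma rank_rad_conj g M : g \in unitmx ->
  \rank (rad_mx (conj_tuple g M)) = \rank (rad_mx M).
Proof.
move=> ug; rewrite -mxrank_tr -act_tr tr_conj_tuple // rank_act_conj.
  by rewrite act_tr mxrank_tr.
by rewrite unitmx_tr unitmx_inv.
Qed.

Lemma rank_rad2_conj g M : g \in unitmx ->
  \rank (rad2_mx (conj_tuple g M)) = \rank (rad2_mx M).
Proof.
move=> ug; rewrite -mxrank_tr -act2_tr tr_conj_tuple // rank_act2_conj.
  by rewrite act2_tr mxrank_tr.
by rewrite unitmx_tr unitmx_inv.
Qed.

End Conjugation.

Section Strata.
Variables (k : closedFieldType) (n : nat) (a : 'M[k]_n) (d0 d1 d2 : nat).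
Let dv := vec3 d0 d1 d2.
Let d := dvec_total dv.

Lemma dvec_totalE : dvec_total dv = (d0 + d1 + d2)%N.
Proof. by rewrite /dvec_total !big_ord_recl big_ord0 /= addn0 addnA. Qed.

Lemma dvec_tailE :
  [/\ dvec_tail dv 0 = (d0 + d1 + d2)%N, dvec_tail dv 1 = (d1 + d2)%N,
      dvec_tail dv 2 = d2 & forall i, (2 < i)%N -> dvec_tail dv i = 0%N].
Proof.
split=> [|||i i2]; rewrite /dvec_tail !big_mkcond !big_ord_recl big_ord0 /=.
- by rewrite addn0 addnA.
- by rewrite addn0.
- by rewrite addn0.
by case: i i2 => [|[|[|i]]].
Qed.

Lemma rad_std_rank m p (B : 'M_(p, d)) : (m <= d)%N ->
  (forall v, (v^T <= B)%MS = (v \in std_flag k d m)) -> \rank B = m.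
Proof.
move=> md Bm; rewrite -[RHS](rank_pid_mx k md md).
by rewrite -(dim_of_rows (fun v => esym (Bm v))) (dim_of_rows (mem_std_flag m)).
Qed.

Lemma rep_std_ranks (N : tuples k n d) : rep_std a N ->
  \rank (act_mx N) = (d1 + d2)%N /\ \rank (act2_mx N) = d2.
Proof.
have [t0 t1 t2 t3] := dvec_tailE; move=> [XN flagN]; split.
  rewrite -mxrank_tr -rad_tr; apply: rad_std_rank => // [|v].
    by rewrite /d dvec_totalE; lia.
  by rewrite -(mod_rad1E N) -mem_mod_rad flagN -/dv t1.
rewrite -mxrank_tr -rad2_tr; apply: rad_std_rank => // [|v].
  by rewrite /d dvec_totalE; lia.
by rewrite -(mod_rad2E N) -mem_mod_rad flagN -/dv t2.
Qed.

Lemma rep_dvec_rep (M : tuples k n d) : rep_dvec a M -> rep_var a M.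
Proof. by move=> [g [N [ug [XN _] ->]]]; exact: conj_rep. Qed.

Lemma rep_dvec_ranks (M : tuples k n d) : rep_dvec a M ->
  \rank (act_mx M) = (d1 + d2)%N /\ \rank (act2_mx M) = d2.
Proof.
move=> [g [N [ug /rep_std_ranks XN ->]]].
by rewrite rank_act_conj // rank_act2_conj.
Qed.

(** The stratum is cut out in the representation variety by the ranks of the
radical layers: a basis adapted to the radical flag conjugates M into the
standard position. *)
Lemma ranks_rep_dvec (M : tuples k n d) : rep_var a M ->
    \rank (act_mx M) = (d1 + d2)%N -> \rank (act2_mx M) = d2 ->
  rep_dvec a M.
Proof.
move=> XM r1 r2; have XT := rep_var_tr XM; have [t0 t1 t2 t3] := dvec_tailE.
pose L := tr_tuple M; pose W2 := <<rad2_mx L>>%MS; pose W1 := <<rad_mx L>>%MS.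
have W21 : (W2 <= W1)%MS by rewrite !genmxE rad2_sub_rad.
have rW2 : \rank W2 = d2 by rewrite genmxE rad2_tr mxrank_tr.
have rW1 : \rank W1 = (d2 + d1)%N by rewrite genmxE rad_tr mxrank_tr r1 addnC.
have [g ug [gW2 gW1]] := flag_basis W21 rW2 rW1.
have ugT : g^T \in unitmx by rewrite unitmx_tr.
exists g^T, (conj_tuple (invmx g^T) M); split => //; last first.
  by rewrite -[LHS](@conj_tupleK _ _ _ (invmx g^T)) ?unitmx_inv // invmxK.
split; first by apply: conj_rep; rewrite ?unitmx_inv.
set N := conj_tuple _ M.
have TN : tr_tuple N = conj_tuple g L.
  by rewrite tr_conj_tuple ?unitmx_inv // invmxK trmxK.
have flag m p (B : 'M_(p, d)) (W : 'M_d) : ((pid_mx m : 'M_d) *m g :=: W)%MS ->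
    (B :=: W *m invmx g)%MS -> forall v, (v^T <= B)%MS = (v \in std_flag k d m).
  move=> gW BW v; rewrite mem_std_flag BW -(eqmxMr _ gW) mulmxK //.
case=> [|[|[|i]]].
- apply/vspaceP => v; rewrite mem_mod_rad mem_std_flag -/dv t0 -dvec_totalE pid_mx_1.
  rewrite submx1; apply: (sumsmx_sup [tuple]) => //.
  by rewrite /word_mx big_nil trmx1 submx1.
- apply/vspaceP => v; rewrite mem_mod_rad mod_rad1E -/dv t1.
  apply: (flag _ _ _ W1); first by rewrite addnC.
  rewrite TN; apply: eqmx_trans (rad_conj L ug) _.
  exact/eqmx_sym/eqmxMr/genmxE.
- apply/vspaceP => v; rewrite mem_mod_rad mod_rad2E -/dv t2.
  apply: (flag _ _ _ W2) => //.
  rewrite TN; apply: eqmx_trans (rad2_conj L ug) _.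
  exact/eqmx_sym/eqmxMr/genmxE.
apply/vspaceP => v; rewrite mem_mod_rad mem_std_flag -/dv t3 // pid_mx_0.
apply/idP/idP; last by move=> v0; apply: submx_trans v0 (sub0mx _ _).
move/submx_trans; apply; apply/sumsmx_subP => w _.
have XN : rep_var a N by apply: conj_rep; rewrite ?unitmx_inv.
by rewrite (word_mx_eq0 XN) ?size_tuple // trmx0 sub0mx.
Qed.

End Strata.

(** * General points of a component *)

Section RegularRanks.
Variables (k : closedFieldType) (n d : nat) (S : Type) (P : (S -> k) -> Prop).
Hypothesis faP : function_algebra P.
Variable f : S -> tuples k n d.
Hypothesis Pf : forall j, fa_mx P (fun s => f s j).

Lemma fa_act_mx : fa_mx P (fun s => act_mx (f s)).
Proof. exact: fa_mx_row. Qed.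

Lemma fa_rad_mx : fa_mx P (fun s => rad_mx (f s)).
Proof. exact: fa_mx_col. Qed.

Lemma fa_act2_mx : fa_mx P (fun s => act2_mx (f s)).
Proof.
by apply: fa_mx_row => // i; apply: fa_mx_mul => //; exact: fa_act_mx.
Qed.

Lemma fa_rad2_mx : fa_mx P (fun s => rad2_mx (f s)).
Proof.
by apply: fa_mx_col => // i; apply: fa_mx_mul => //; exact: fa_rad_mx.
Qed.

End RegularRanks.

Section ZeroLayers.
Variables (k : closedFieldType) (n d : nat).
Implicit Types (M : tuples k n d).

Lemma rad_mx_eq0 M : rad_mx M = 0 <-> forall j, M j = 0.
Proof.
rewrite -(@mxcol0 k n (fun=> d)); split => [/eq_mxcolP //|M0]; exact: eq_mxcol.
Qed.

Lemma act_mx_eq0 M : act_mx M = 0 <-> forall j, M j = 0.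
Proof.
rewrite -(@mxrow0 k n (fun=> d)); split => [/eq_mxrowP //|M0]; exact: eq_mxrow.
Qed.

Lemma rad2_mx_eq0 M : rad2_mx M = 0 -> forall i j, M i *m M j = 0.
Proof.
rewrite rad2_mxE -(@mxcol0 k n (fun=> \sum_(j < n) d)%N) => /eq_mxcolP R2 i j.
by have := R2 j; rewrite -(@mxcol0 k n (fun=> d)) => /eq_mxcolP.
Qed.

Lemma act2_mx_eq0 M : (forall i j, M i *m M j = 0) -> act2_mx M = 0.
Proof.
move=> M2; rewrite act2_mxE -(@mxrow0 k n (fun=> \sum_(j < n) d)%N).
by apply: eq_mxrow => i; rewrite -(@mxrow0 k n (fun=> d)); apply: eq_mxrow => j.
Qed.

Lemma rad_sub_soc M : (forall i j, M i *m M j = 0) ->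
  (rad_mx M <= kermx (act_mx M))%MS.
Proof.
move=> M2; apply/mxcol_sub => i; apply/sub_kermxP.
by rewrite mul_act_mx -(@mxrow0 k n (fun=> d)); apply: eq_mxrow => j.
Qed.

End ZeroLayers.

Section Generic.
Variables (k : closedFieldType) (n : nat) (a : 'M[k]_n) (d0 d1 d2 : nat).
Hypothesis det_a : \det a != 0.
Let dv := vec3 d0 d1 d2.
Let d := dvec_total dv.
Hypothesis comp : irreducible_component (@rep_var k n a d)
  (zariski_closure (@rep_dvec k n a dv)).

Lemma generic_open : exists Z : set (tuples k n d),
  [/\ zariski_closed Z, exists2 M, rep_dvec a M & ~ Z M &
      forall M, rep_var a M -> ~ Z M -> zariski_closure (@rep_dvec k n a dv) M].
Proof.
pose I := ({pq : 'I_d.+1 * 'I_d.+1 | (pq.1 + pq.2 <= d)%N} * 'I_(n * d).+1)%type.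
pose Y (i : I) : set (tuples k n d) := chart_image a (sval i.1).1 (sval i.1).2 i.2.
have [i|i|M XM|Z [clZ CZ XZ]] := component_open (Y := Y) (@rep_var_closed k n d a)
    (@zariski_closure_closed _ _ _ _) comp.
- exact: chart_irreducible.
- by move=> M [h [L [H [Y0 [C ->]]]]]; apply: chart_rep => //; case: (i.1).
- have [p [q [r [pq rn cM]]]] := chart_cover det_a XM.
  have pd : (p < d.+1)%N by lia.
  have qd : (q < d.+1)%N by lia.
  have rn' : (r < (n * d).+1)%N by [].
  by exists (exist (fun pq : 'I_d.+1 * 'I_d.+1 => pq.1 + pq.2 <= d)%N
    (Ordinal pd, Ordinal qd) pq, Ordinal rn').
exists Z; split=> //; apply: contrapT => noM; apply: CZ.
apply: zariski_closure_sub => // M dM; apply: contrapT => ZM.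
by apply: noM; exists M.
Qed.

Lemma closure_rank_le (M : tuples k n d) : zariski_closure (@rep_dvec k n a dv) M ->
  (\rank (act_mx M) <= d1 + d2)%N /\ (\rank (act2_mx M) <= d2)%N.
Proof.
have faR := regular_algebra k n d; have regM := @regular_coord k n d.
move=> CM; split.
  apply: (zariski_closure_sub (rank_le_closed (d1 + d2) (fa_act_mx faR regM)) _ CM).
  by move=> N /rep_dvec_ranks [/= ->].
apply: (zariski_closure_sub (rank_le_closed d2 (fa_act2_mx faR regM)) _ CM).
by move=> N /rep_dvec_ranks [_ /= ->].
Qed.

(** In the part of the stratum outside the closed set of [generic_open], M maximizes
the sum of the two socle codimensions, and G consists of the points with the
same two values as M.  At the general point of a line both values can only go up
and their sum cannot, so both stay the same.  The open subset of
[rep_std] consists of the N whose conjugate h N h^-1, for a fixed h that carries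
some point of [rep_std] to M, lies in G. *)
Theorem generic_layers : exists (G : tuples k n d -> Prop) M,
  [/\ generic_class a G, G M, rep_dvec a M &
      generic_sdim a dv (vec3 (d - \rank (rad_mx M))
        (\rank (rad_mx M) - \rank (rad2_mx M)) (\rank (rad2_mx M)))].
Proof.
have [Z [clZ [M0 dM0 ZM0] XZ]] := generic_open.
pose Om M := rep_dvec a M /\ ~ Z M.
pose f (M : tuples k n d) := (\rank (rad_mx M) + \rank (rad2_mx M))%N.
pose Q m := `[< exists2 M, Om M & f M = m >].
have exQ : exists m, Q m by exists (f M0); apply/asboolP; exists M0.
have boundQ m : Q m -> (m <= d + d)%N.
  by move=> /asboolP [M _ <-]; apply: leq_add; exact: rank_leq_col.
have [fmax /asboolP [M [dM ZM] fM] maxf] := ex_maxnP exQ boundQ.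
pose G N := [/\ Om N, \rank (rad_mx N) = \rank (rad_mx M) &
  \rank (rad2_mx N) = \rank (rad2_mx M)].
have OmG N : Om N -> (\rank (rad_mx M) <= \rank (rad_mx N))%N ->
    (\rank (rad2_mx M) <= \rank (rad2_mx N))%N -> G N.
  move=> OmN r1 r2; have : (f N <= f M)%N.
    by rewrite fM; apply: maxf; apply/asboolP; exists N.
  have sum_eq (x y x' y' : nat) : (x <= x' -> y <= y' -> x' + y' <= x + y ->
      x' = x /\ y' = y)%N by clear; lia.
  by move/(sum_eq _ _ _ _ r1 r2) => [? ?].
exists G, M; split=> //.
- split=> [N [[dN _] _ _]|N E [[dN ZN] r1 r2] XE|N N' [[/rep_dvec_ranks [a1 a2] _] b1 b2] [[/rep_dvec_ranks [a1' a2'] _] b1' b2']].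
  + exact: rep_dvec_rep.
  + have pc := line_curve N E; have N0 : N + 0 *: E = N by rewrite scale0r addr0.
    have ZN0 : ~ Z (N + 0 *: E) by rewrite N0.
    have [q q0 Zq] := curve_leaves_closed clZ pc ZN0.
    have faP := poly_fun_algebra k.
    have [p1 p10 rk1] := rank_curve 0 (fa_act_mx faP pc).
    have [p2 p20 rk2] := rank_curve 0 (fa_act2_mx faP pc).
    have [p3 p30 rk3] := rank_curve 0 (fa_rad_mx faP pc).
    have [p4 p40 rk4] := rank_curve 0 (fa_rad2_mx faP pc).
    rewrite N0 in rk1 rk2 rk3 rk4.
    have [e1 e2] := rep_dvec_ranks dN.
    exists (q * p1 * p2 * p3 * p4).
      by rewrite !mulf_neq0 ?(horner_neq0 q0) ?(horner_neq0 p10) ?(horner_neq0 p20)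
        ?(horner_neq0 p30) ?(horner_neq0 p40).
    move=> e; rewrite !hornerM !mulf_eq0 !negb_or.
    move=> /andP [/andP [/andP [/andP [qe p1e] p2e] p3e] p4e].
    have Ze := Zq e qe; have [l1 l2] := closure_rank_le (XZ _ (XE e) Ze).
    have := rk1 e p1e; have := rk2 e p2e; rewrite e1 e2 => g2 g1.
    apply: OmG; [split => // | by rewrite -r1 rk3 | by rewrite -r2 rk4].
    by apply: ranks_rep_dvec => //; apply/eqP; rewrite eqn_leq ?l1 ?l2.
  + by rewrite /layer_ranks a1 a2 a1' a2' b1 b2 b1' b2'.
have [h [N [uh NS defM]]] := dM.
have faR := regular_algebra k n d; have regM := @regular_coord k n d.
pose U := [set N' | Z (conj_tuple h N')]%classic.
pose U1 := [set N' : tuples k n d | (\rank (rad_mx N') < \rank (rad_mx M))%N]%classic.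
pose U2 := [set N' : tuples k n d | (\rank (rad2_mx N') < \rank (rad2_mx M))%N]%classic.
exists (@rep_std k n a dv `\` (U `|` (U1 `|` U2)))%classic; split.
- exists (U `|` (U1 `|` U2))%classic => //; apply: zariski_closedU.
    by apply: zariski_closed_preimage => // j; exact: conj_regular.
  by apply: zariski_closedU; apply: rank_lt_closed; [exact: fa_rad_mx | exact: fa_rad2_mx].
- exists N; split=> //= -[|[]]; rewrite /U /U1 /U2 /= ?defM ?rank_rad_conj ?rank_rad2_conj ?ltnn //.
  by rewrite -defM.
move=> N' [N'S /not_orP [ZN' /not_orP [/negP r1 /negP r2]]].
rewrite -leqNgt in r1; rewrite -leqNgt in r2.
have [] : G (conj_tuple h N').
  by apply: OmG; rewrite ?rank_rad_conj ?rank_rad2_conj //; split=> //; exists h, N'.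
rewrite rank_rad_conj // rank_rad2_conj // => _ <- <-.
by apply: (sdimE (a := a)); case: N'S.
Qed.

End Generic.

(** * The generic socle layering *)

Lemma vec3_inj x y z x' y' z' : vec3 x y z = vec3 x' y' z' ->
  [/\ x = x', y = y' & z = z'].
Proof. by move=> /(congr1 val) /= [-> -> ->]. Qed.

(** On columns, the radical dimensions d1 + d2 and d2 are the socle codimensions of
the row module; so the two exceptional cases of [layer_trichotomy] become the
second and the first family. *)
Lemma component_trichotomy (k : closedFieldType) n (a : 'M[k]_n) d0 d1 d2 :
    \det a != 0 -> (1 < n)%N ->
    vec3 d0 d1 d2 <> vec3 1%N 0%N 0%N -> vec3 d0 d1 d2 <> vec3 1%N 1%N 0%N ->
    irreducible_component (@rep_var k n a (dvec_total (vec3 d0 d1 d2)))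
      (zariski_closure (@rep_dvec k n a (vec3 d0 d1 d2))) ->
  let D := (d0 + d1 + d2)%N in exists r1 r2 : nat,
    generic_sdim a (vec3 d0 d1 d2) (vec3 (D - r1) (r1 - r2) r2) /\
    [\/ dual_ranks n D r1 r2 (d1 + d2) d2,
        exceptional_ranks n D r1 r2 (d1 + d2) d2
      | exceptional_ranks n D (d1 + d2) d2 r1 r2].
Proof.
move=> ha hn hdv1 hdv2 hcomp D.
have [G [M [genG GM dM gs]]] := generic_layers ha hcomp.
have [c1E c2E] := rep_dvec_ranks dM; have XM := rep_dvec_rep dM.
have totalE := dvec_totalE d0 d1 d2.
have not_simple : ~ (dvec_total (vec3 d0 d1 d2) = 1 /\ \rank (rad_mx M) = 0)%N.
  move=> [d_1 /eqP]; rewrite mxrank_eq0 => /eqP/rad_mx_eq0/act_mx_eq0 act0.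
  move: c1E; rewrite act0 mxrank0 => e; apply: hdv1.
  by congr vec3; move: totalE e; rewrite d_1; clear; lia.
have not_uniserial : ~ (dvec_total (vec3 d0 d1 d2) = 2 /\ \rank (rad_mx M) = 1 /\
    \rank (rad2_mx M) = 0)%N.
  move=> [d_2 [r1 /eqP]]; rewrite mxrank_eq0 => /eqP/rad2_mx_eq0 M2.
  have d20 : d2 = 0%N by rewrite -c2E act2_mx_eq0 ?mxrank0.
  have c1_le1 : (\rank (act_mx M) <= 1)%N.
    move: (rad_sub_soc M2) => /mxrankS; rewrite mxrank_ker r1.
    by move: (\rank (act_mx M)) d_2 => c; move: (dvec_total _) => m; clear; lia.
  have c1_gt0 : \rank (act_mx M) != 0%N.
    rewrite mxrank_eq0; apply/eqP => /act_mx_eq0/rad_mx_eq0 rad0.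
    by move: r1; rewrite rad0 mxrank0.
  rewrite c1E in c1_le1 c1_gt0; apply: hdv2.
  by congr vec3; move: totalE c1_le1 c1_gt0; rewrite d_2 d20; clear; lia.
exists (\rank (rad_mx M)), (\rank (rad2_mx M)); rewrite -[D]totalE; split=> //.
by have := layer_trichotomy ha hn genG GM not_simple not_uniserial; rewrite /= c1E c2E.
Qed.

Local Close Scope ring_scope.

(* hn, hdv1 and hdv2 exclude the degenerate cases n <= 1, (1,0,0) and (1,1,0),
   in which d_2 = 0 and the formula would predict a zero socle. *)
Theorem theorem1p3 (k : closedFieldType) (n : nat) (a : 'M[k]_n)
    (d0 d1 d2 : nat)
    (hchar : 2%N \notin [pchar k]%R)
    (ha : (\det a != 0)%R)
    (hn : (1 < n)%N)
    (hdv1 : vec3 d0 d1 d2 <> vec3 1 0 0)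
    (hdv2 : vec3 d0 d1 d2 <> vec3 1 1 0)
    (hcomp : irreducible_component
               (@rep_var k n a (dvec_total (vec3 d0 d1 d2)))
               (zariski_closure (@rep_dvec k n a (vec3 d0 d1 d2)))) :
  [/\ forall b : nat, (0 < b)%N -> vec3 d0 d1 d2 = layering1 n b ->
        generic_sdim a (vec3 d0 d1 d2) (layering2 n b),
      forall b : nat, (0 < b)%N -> vec3 d0 d1 d2 = layering2 n b ->
        generic_sdim a (vec3 d0 d1 d2) (layering1 n b)
    & (forall b : nat, (0 < b)%N ->
         vec3 d0 d1 d2 <> layering1 n b /\ vec3 d0 d1 d2 <> layering2 n b) ->
        generic_sdim a (vec3 d0 d1 d2) (vec3 d2 d1 d0)].
Proof.
have [r1 [r2 [gs tri]]] := component_trichotomy ha hn hdv1 hdv2 hcomp.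
have {}gs s0 s1 s2 : s0 = d0 + d1 + d2 - r1 -> s1 = r1 - r2 -> s2 = r2 ->
    generic_sdim a (vec3 d0 d1 d2) (vec3 s0 s1 s2).
  by move=> -> -> ->.
(* The middle entries of the two families differ modulo n. *)
have no_mod x y : (n * x + 1)%N <> (n * y)%N.
  by move/(congr1 (modn^~ n)); rewrite modnMr mulnC modnMDl modn_small.
have sb b : (b.+1 - 1 = b)%N by rewrite subn1.
split=> [[//|b] _ /vec3_inj|[//|b] _ /vec3_inj|not_exc]; rewrite ?subn1 /=.
- move=> [e0 e1 e2]; case: tri => [[h1 h2 h3 h4 h5]|[[//|c] _]|[[//|c] _]].
  + have r12 : (r1 - r2 = n * b)%N by clear - h1 h2 e0 e1; lia.
    have sq : (n ^ 2 * b = (n ^ 2 - 1) * b + b)%N.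
      by rewrite -{3}[b]mul1n -mulnDl subnK ?expn_gt0 ?(ltnW hn).
    move: h4; rewrite r12 mulnA mulnn sq e2; clear - h1 e0; lia.
  + rewrite subn1 /= => -[h1 h2 h3 [h4 h5 h6]]; case: (no_mod c b).
    by clear - h5 h6 e1; lia.
  + rewrite subn1 /= => -[h1 h2 h3 [h4 h5 h6]].
    have cb : c = b by clear - h1 e0; lia.
    by rewrite cb in h1 h2 h3 h4 h5 h6; apply: gs; rewrite ?sb -?h3; clear - h1 h2 h3 h4 h5 h6; lia.
- move=> [e0 e1 e2]; case: tri => [[h1 h2 h3 h4 h5]|[[//|c] _]|[[//|c] _]].
  + have : (n * b + 1 <= n * b)%N by move: h5; rewrite e2; clear - h1 h2 e1; lia.
    by rewrite addn1 ltnn.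
  + rewrite subn1 /= => -[h1 h2 h3 [h4 h5 h6]].
    have cb : c = b by clear - h6 e2; lia.
    by rewrite cb in h1 h2 h3 h4 h5 h6; apply: gs; rewrite ?sb -?h3; clear - h1 h2 h3 h4 h5 h6; lia.
  + rewrite subn1 /= => -[h1 h2 h3 [h4 h5 h6]]; case: (no_mod b c).
    by clear - h2 e1; lia.
case: tri => [[h1 h2 h3 h4 h5]|[b b0]|[b b0]].
- by apply: gs; clear - h1 h2 h3; lia.
- move=> [h1 h2 h3 [h4 h5 h6]]; case: (not_exc b b0) => _ [].
  by congr vec3; clear - h1 h2 h3 h4 h5 h6; lia.
move=> [h1 h2 h3 [h4 h5 h6]]; case: (not_exc b b0) => [[]].
by congr vec3; clear - h1 h2 h3 h4 h5 h6; lia.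
Qed.
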